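(* Let $t\in[1,\infty)$, let $c\ge2$ be an integer and let $\pi=(\pi_0,\dots,\pi_{c-1})\in(0,1)^c$ be a probability vector, i.e. $\sum_{b=0}^{c-1}\pi_b=1$. Let $U'_{\pi,t}$ be the set of all $x\in\mathbb{R}$ for which there is a sequence $(p_n/q_n)_{n\in\mathbb{N}}$ of irreducible fractions ($p_n\in\mathbb{Z}$, $q_n\in\mathbb{N}$) such that $q_n\to\infty$, $|x-p_n/q_n|\le q_n^{-2t}$ for all $n$, and $\sigma_{b,\lfloor2\log_cq_n\rfloor}(x)\to\pi_b$ as $n\to\infty$ for all $b\in\{0,\dots,c-1\}$. Let $\alpha=-\sum_{b=0}^{c-1}\pi_b\log_c\pi_b$ and, for $\eta\in(0,1/8)$, let $f_\eta(r)=(-\log r)^{\eta-1/8}$. Then, for each $\eta\in(0,1/8)$, the set $U'_{\pi,t}$ contains a set of the class $\mathrm{G}^{h_{\alpha/t,3f_\eta}}(\mathbb{R})$, where $h_{\alpha/t,3f_\eta}(r)=r^{\alpha/t-3f_\eta(r)}$.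
   Context: Digits. Each real $x$ is written $x=x_0+\sum_{p\ge1}x_pc^{-p}$ with $x_0\in\mathbb{Z}$ and digits $x_p\in\{0,\dots,c-1\}$ ($p\in\mathbb{N}$) not eventually constantly equal to $c-1$; for $b\in\{0,\dots,c-1\}$ and $j\in\mathbb{N}$, $\sigma_{b,j}(x)=\frac1j\#\{p\in\{1,\dots,j\}: x_p=b\}$. (In $\sigma_{b,\lfloor2\log_cq_n\rfloor}$ the index is positive for all large $n$.) Gauge functions and large intersection classes in $\mathbb{R}$. $\mathfrak{D}_1$ is the set of all functions $h$ that vanish at zero, are continuous and nondecreasing on $[0,\varepsilon]$ and are such that $r\mapsto h(r)/r$ is positive and nonincreasing on $(0,\varepsilon]$, for some $\varepsilon>0$ (only behaviour near zero matters; functions such as $h_{\alpha/t,3f_\eta}$ are extended by $0$ at $0$). For $g,h\in\mathfrak{D}_1$, $g\prec h$ means that $g/h$ monotonically tends to infinity at zero. For $h\in\mathfrak{D}_1$ let $\varepsilon_h$ be the supremum of all $\varepsilon\in(0,1]$ such that $h$ is continuous and nondecreasing on $[0,\varepsilon]$ and $h(r)/r$ is positive and nonincreasing on $(0,\varepsilon]$. Let $\Lambda_c$ be the collection of $c$-adic intervals $c^{-j}(k+[0,1))$, $j,k\in\mathbb{Z}$. For $F\subseteq\mathbb{R}$, $\mathcal{M}^h_\infty(F)=\inf\sum_{p\ge1}h(|\lambda_p|)$, the infimum being over all sequences $(\lambda_p)_{p\in\mathbb{N}}$ in $\Lambda_c\cup\{\emptyset\}$ with $F\subseteq\bigcup_p\lambda_p$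 and $|\lambda_p|<\varepsilon_h$ for all $p$ ($|\cdot|$ denotes diameter). For $h\in\mathfrak{D}_1$, $\mathrm{G}^h(\mathbb{R})$ is the collection of all $G_\delta$-subsets $F$ of $\mathbb{R}$ such that $\mathcal{M}^g_\infty(F\cap U)=\mathcal{M}^g_\infty(U)$ for every $g\in\mathfrak{D}_1$ with $g\prec h$ and every open $U\subseteq\mathbb{R}$. (It is known that this class does not depend on the integer base used for the intervals.) *)

(* Defs.v *)
From mathcomp Require Import all_boot all_order all_algebra.
From mathcomp Require Import all_classical all_reals all_analysis.
From mathcomp Require Import borel_hierarchy.

Set Implicit Arguments.
Unset Strict Implicit.
Unset Printing Implicit Defensive.

Import Order.TTheory GRing.Theory Num.Theory.
Import numFieldNormedType.Exports.

Local Open Scope classical_set_scope.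
Local Open Scope ring_scope.

Definition logb {R : realType} (c : nat) (x : R) : R := ln x / ln c%:R.

(* The digits are d 1, d 2, ...; the value d 0 is not used. *)
Definition is_expansion {R : realType} (c : nat) (x : R) (x0 : int)
    (d : nat -> nat) : Prop :=
  [/\ forall p, (0 < p)%N -> (d p < c)%N,
      ~ (\forall p \near \oo, d p = c.-1)
    & (x0%:~R + \sum_(1 <= p < n.+1) (d p)%:R / c%:R ^+ p) @[n --> \oo] --> x].

(* For c >= 2 every real has exactly one expansion (up to the unused d 0), so
   xget selects it and the default value plays no role. *)
Definition digits {R : realType} (c : nat) (x : R) : nat -> nat :=
  xget (fun=> 0%N) [set d | exists x0 : int, is_expansion c x x0 d].

Definition sigma {R : realType} (c b j : nat) (x : R) : R :=
  (count (fun p => digits c x p == b) (iota 1 j))%:R / j%:R.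

Definition U' {R : realType} (c : nat) (pi_ : 'I_c -> R) (t : R) : set R :=
  [set x : R | exists (p : nat -> int) (q : nat -> nat),
    [/\ forall n, (0 < q n)%N /\ coprime `|p n|%N (q n),
        q n @[n --> \oo] --> \oo,
        forall n, `|x - (p n)%:~R / (q n)%:R| <= (q n)%:R `^ (- (2 * t))
      & forall b : 'I_c,
          sigma c b (Num.truncn (2 * logb c ((q n)%:R : R))) x @[n --> \oo]
            --> pi_ b]].

(* Gauge functions are total functions on R; only their values on [0, 1] are
   ever used. *)
Definition gauge_on {R : realType} (h : R -> R) (e : R) : Prop :=
  [/\ {within `[0, e], continuous h},
      forall r s : R, 0 <= r -> r <= s -> s <= e -> h r <= h s,
      forall r : R, 0 < r -> r <= e -> 0 < h r / r
    & forall r s : R, 0 < r -> r <= s -> s <= e -> h s / s <= h r / r].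

Definition gaugeD1 {R : realType} (h : R -> R) : Prop :=
  h 0 = 0 /\ exists2 e : R, 0 < e & gauge_on h e.

Definition gauge_prec {R : realType} (g h : R -> R) : Prop :=
  (exists2 e : R, 0 < e &
    forall r s : R, 0 < r -> r <= s -> s <= e -> g s / h s <= g r / h r) /\
  g r / h r @[r --> 0^'+] --> +oo.

Definition gauge_eps {R : realType} (h : R -> R) : R :=
  sup [set e : R | [/\ 0 < e, e <= 1 & gauge_on h e]].

Definition cadic {R : realType} (c : nat) : set (set R) :=
  [set A : set R | exists j k : int,
    A = `[c%:R ^ (- j) * k%:~R, c%:R ^ (- j) * (k%:~R + 1)[%classic].

(* Real-valued, hence meaningful for bounded sets only; diam set0 = 0 because
   sup set0 = 0. *)
Definition diam {R : realType} (A : set R) : R :=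
  sup [set `|x - y| | x in A & y in A].

Definition net_measure {R : realType} (c : nat) (h : R -> R) (F : set R) :
    \bar R :=
  ereal_inf [set (\sum_(0 <= p <oo) (h (diam (l p)))%:E)%E |
    l in [set l : nat -> set R |
      [/\ forall p, cadic c (l p) \/ l p = set0,
          F `<=` \bigcup_p l p
        & forall p, diam (l p) < gauge_eps h]]].

Definition large_intersection {R : realType} (c : nat) (h : R -> R) :
    set (set R) :=
  [set F : set R | Gdelta F /\
    forall g : R -> R, gaugeD1 g -> gauge_prec g h ->
    forall U : set R, open U -> net_measure c g (F `&` U) = net_measure c g U].

Definition f_ {R : realType} (eta r : R) : R := (- ln r) `^ (eta - 8^-1).

(* r |-> r ^ (a - f r), extended by 0 at 0; h_{alpha/t, 3 f_eta} is obtained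
   for a = alpha / t and f = 3 f_eta. *)
Definition h_ {R : realType} (a : R) (f : R -> R) (r : R) : R :=
  if r == 0 then 0 else r `^ (a - f r).

Definition entropy {R : realType} (c : nat) (pi_ : 'I_c -> R) : R :=
  - \sum_(b < c) pi_ b * logb c (pi_ b).

(* Main.v *)
(* The approximating set is F, the intersection over N of the interiors of the
   sets of points x having an irreducible p/q with q >= N, |x - p/q| <= q^(-2t)
   and digit frequencies within 1/(N+1) of pi up to rank 2 log_c q.

   Fix a gauge g that is large compared with h, a c-adic interval J and a family
   of c-adic intervals contained in J whose total cost C(J), the sum of their
   gauges, is less than g(|J|).  It is enough to find a point of F in J that the
   family misses.  Descend first along children of least cost: the cost decreases
   at least like Lebesgue measure.  Then choose the digits one by one so that
   C(w)/mu(w) plus a penalty for the deviation of the digit counts, a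
   supermartingale for the Bernoulli measure mu of parameter pi, never increases.
   This yields a point y along which the cost is O(mu) and the first n digits have
   frequencies pi up to n^(3/4)/n.  Adding to the cost a small atomic measure
   charging all rationals makes y irrational, so Dirichlet gives p/q with
   |y - p/q| < q^-2 and q as large as desired.  Balanced digits keep y far from the
   ends of its c-adic intervals, so p/q lies in the interval of y of some level
   2 log_c q - O((log q)^(3/4)), where the cost is at most
   q^(-2 alpha) exp(O((log q)^(3/4))) < g(q^(-2t)).  A c-adic interval around p/q of
   length about q^(-2t) therefore has cost less than its gauge and the construction
   can be repeated inside it with the next N; the nested intervals shrink to a
   point of F that is not covered.

   Equality of the net measures follows by replacing, in a cover of F `&` U, the
   elements inside a maximal c-adic interval of U by that interval. *)

Require Import Defs.
From mathcomp Require Import all_boot all_order all_algebra archimedean.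
From mathcomp Require Import all_classical all_reals all_analysis.
From mathcomp Require Import ring lra zify.

Set Implicit Arguments.
Unset Strict Implicit.
Unset Printing Implicit Defensive.

Import Order.TTheory GRing.Theory Num.Theory.
Import numFieldNormedType.Exports.

Local Open Scope classical_set_scope.
Local Open Scope ring_scope.

(** * c-adic digits *)

(** The index of the c-adic interval of level [i] containing [x]. Taking [cint] as a fibre of this
    map turns nesting and digits into integer division by [c]. *)
Definition cfloor {R : realType} (c i : nat) (x : R) : int :=
  Num.floor (c%:R ^+ i * x).

Definition cint {R : realType} (c i : nat) (k : int) : set R :=
  [set x | cfloor c i x = k].

Definition cdigit {R : realType} (c p : nat) (x : R) : nat :=
  `|(cfloor c p x %% c)%Z|%N.

Section Digits.
Context (R : realType) (c : nat) (hc : (2 <= c)%N).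
Implicit Types (x y : R) (i j p n : nat) (k : int).

Let c_gt0 : 0 < c%:R :> R. Proof. by rewrite ltr0n; lia. Qed.

Lemma cexp_gt0 i : 0 < c%:R ^+ i :> R. Proof. exact: exprn_gt0. Qed.

Lemma cfloor_itv i x :
  (cfloor c i x)%:~R <= c%:R ^+ i * x < (cfloor c i x)%:~R + 1.
Proof. by have := floor_itv (c%:R ^+ i * x); rewrite intrD. Qed.

Lemma cintP i k x :
  cint c i k x <-> k%:~R <= c%:R ^+ i * x < k%:~R + 1.
Proof.
split=> [<-|h]; first exact: cfloor_itv.
by apply: floor_def; rewrite intrD.
Qed.

Lemma cintP' i k x :
  cint c i k x <-> k%:~R / c%:R ^+ i <= x < (k%:~R + 1) / c%:R ^+ i.
Proof.
rewrite cintP ler_pdivrMr ?cexp_gt0// ltr_pdivlMr ?cexp_gt0//.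
by rewrite mulrC.
Qed.

Lemma cfloor_div i x : cfloor c i x = (cfloor c i.+1 x %/ c)%Z.
Proof.
apply: floor_def.
have /andP[h1 h2] := cfloor_itv i.+1 x.
set K := cfloor c i.+1 x in h1 h2 *.
have hK := divz_eq K c.
have c0 : (c%:Z != 0)%R by lia.
have r0 := modz_ge0 K c0.
have r1 : ((K %% c)%Z < c%:Z)%R by apply: ltz_pmod; lia.
rewrite exprS -mulrA in h1 h2.
have e : (K%:~R = (K %/ c)%Z%:~R * c%:R + (K %% c)%Z%:~R :> R).
  by rewrite {1}hK intrD intrM.
have r0' : 0 <= (K %% c)%Z%:~R :> R by rewrite ler0z.
have r1' : (K %% c)%Z%:~R + 1 <= c%:R :> R.
  have -> : c%:R = c%:Z%:~R :> R by [].
  have -> : 1 = (1:int)%:~R :> R by [].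
  by rewrite -intrD ler_int; lia.
rewrite intrD.
apply/andP; split.
  rewrite -(ler_pM2l c_gt0); apply: le_trans h1; rewrite e; nra.
rewrite -(ltr_pM2l c_gt0); apply: (lt_le_trans h2); rewrite e.
rewrite mulrDr; nra.
Qed.

Lemma cfloorS i x : cfloor c i.+1 x = cfloor c i x * c + (cdigit c i.+1 x)%:Z.
Proof.
rewrite {1}(divz_eq (cfloor c i.+1 x) c) -cfloor_div /cdigit.
by rewrite gez0_abs// modz_ge0//; lia.
Qed.

Lemma cdigit_lt p x : (cdigit c p x < c)%N.
Proof.
rewrite /cdigit -ltz_nat gez0_abs ?modz_ge0//; last by lia.
by apply: ltz_pmod; lia.
Qed.

Lemma cfloor_le i j x y : (i <= j)%N -> cfloor c j x = cfloor c j y ->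
  cfloor c i x = cfloor c i y.
Proof.
move=> /subnKC <-; elim: (j - i)%N => [|m IH]; first by rewrite addn0.
by rewrite addnS => h; apply: IH; rewrite !(cfloor_div (i + m)) h.
Qed.

Let psum (x0 : int) (d : nat -> nat) n : R :=
  x0%:~R + \sum_(1 <= p < n.+1) (d p)%:R / c%:R ^+ p.

Let psumS (x0 : int) d n : psum x0 d n.+1 = psum x0 d n + (d n.+1)%:R / c%:R ^+ n.+1.
Proof. by rewrite /psum big_nat_recr//= addrA. Qed.

Let psum_cfloor x n : psum (cfloor c 0 x) (cdigit c ^~ x) n =
  (cfloor c n x)%:~R / c%:R ^+ n.
Proof.
elim: n => [|n IH]; first by rewrite /psum big_nil expr0 addr0 divr1.
rewrite psumS IH cfloorS intrD intrM exprS.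
by have := cexp_gt0 n => ?; field; rewrite !lt0r_neq0.
Qed.

Lemma cinv_cvg0 : (c%:R ^- n @[n --> \oo] --> (0 : R))%R.
Proof.
rewrite (_ : (fun n => _) = (fun n => (c%:R^-1 : R) ^+ n)); last first.
  by apply/funext => n; rewrite exprVn.
apply: cvg_expr; rewrite ger0_norm ?invr_ge0 ?ler0n//.
by rewrite invf_lt1// ltr1n.
Qed.

Lemma cinv_lt (e : R) : 0 < e -> exists N, forall n, (N <= n)%N -> c%:R ^- n < e.
Proof.
move=> e0; have /cvgrPdist_lt /(_ _ e0) [N _ h] := cinv_cvg0.
exists N => n /h; rewrite sub0r normrN ger0_norm// invr_ge0 ltW// cexp_gt0.
Qed.

Lemma is_expansion_cdigit x : is_expansion c x (cfloor c 0 x) (cdigit c ^~ x).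
Proof.
split.
- by move=> p _; exact: cdigit_lt.
- move=> [N _ hN].
  (* If all digits after [N] were [c.-1], then [c ^ N x] would be within [c ^- m] of the right end
     of its unit interval for every [m]. *)
  have hN' m : cfloor c (N + m) x + 1 = (c ^ m)%N%:Z * (cfloor c N x + 1).
    elim: m => [|m IH]; first by rewrite addn0 expn0 mul1r.
    rewrite addnS cfloorS (hN (N + m).+1)/=; last by lia.
    rewrite expnS PoszM -mulrA -IH; lia.
  have /andP[_ h] := cfloor_itv N x.
  set e := (cfloor c N x)%:~R + 1 - c%:R ^+ N * x.
  have e0 : 0 < e by rewrite /e; lra.
  have [m hm] := cinv_lt e0.
  have := hm m (leqnn _).
  have /andP[h1 _] := cfloor_itv (N + m) x.
  have : (cfloor c (N + m) x)%:~R = c%:R ^+ m * ((cfloor c N x)%:~R + 1) - 1 :> R.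
    have := hN' m => /(congr1 (fun k : int => k%:~R : R)).
    rewrite intrD intrM intrD -pmulrn natrX => <-; ring.
  move=> h3; rewrite h3 exprD in h1.
  have cm := cexp_gt0 m.
  rewrite -[_ ^- _]mul1r ltr_pdivrMr// /e; nra.
- rewrite (_ : (fun n => _) = (fun n => (cfloor c n x)%:~R / c%:R ^+ n)); last first.
    by apply/funext => n; exact: psum_cfloor.
  apply/cvgrPdist_lt => e /cinv_lt [N hN]; exists N => // n /= /hN.
  apply: le_lt_trans.
  have /andP[h1 h2] := cfloor_itv n x.
  have cn := cexp_gt0 n.
  have -> : x - (cfloor c n x)%:~R / c%:R ^+ n =
     (c%:R ^+ n * x - (cfloor c n x)%:~R) / c%:R ^+ n by field; rewrite lt0r_neq0.
  rewrite ger0_norm; last by rewrite divr_ge0 ?(ltW cn)//; lra.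
  by rewrite ler_pdivrMr// mulVf ?lt0r_neq0//; lra.
Qed.

(** The partial sums [psum] increase and the sums [T] decrease, with [x] in between. The upper bound
    is strict because a digit other than [c.-1] always follows, so each partial sum is the left end
    of the c-adic interval of [x]. *)
Lemma is_expansion_uniq x (x0 : int) d p : is_expansion c x x0 d -> (0 < p)%N ->
  d p = cdigit c p x.
Proof.
move=> [hd hne hcv].
pose N := fix N n : int := if n is n'.+1 then N n' * c + (d n)%:Z else x0.
have SN n : psum x0 d n = (N n)%:~R / c%:R ^+ n.
  elim: n => [|n IH]; first by rewrite /psum big_nil expr0 addr0 divr1.
  rewrite psumS IH /= intrD intrM exprS.
  by have := cexp_gt0 n => ?; field; rewrite !lt0r_neq0.
have incS n : psum x0 d n <= psum x0 d n.+1.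
  by rewrite psumS lerDl divr_ge0// ltW// cexp_gt0.
pose T n := psum x0 d n + c%:R ^- n.
have TS n : T n - T n.+1 = (c%:R - (d n.+1)%:R - 1) * c%:R ^- n.+1.
  rewrite /T psumS exprS.
  by have := cexp_gt0 n => ?; field; rewrite !lt0r_neq0.
have decT n : T n.+1 <= T n.
  rewrite -subr_ge0 TS mulr_ge0// ?invr_ge0 ?(ltW (cexp_gt0 _))//.
  have := hd n.+1 isT; rewrite -(ler_nat R) => h.
  by rewrite -natr1 in h; lra.
have leS n : psum x0 d n <= x.
  rewrite -(cvg_lim _ hcv)//.
  apply: (nondecreasing_cvgn_le (u_ := psum x0 d)) => //.
    by apply/nondecreasing_seqP => m; exact: incS.
  by apply/cvg_ex; exists x.
have decTm n m : T (n + m)%N <= T n.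
  elim: m => [|m IH]; first by rewrite addn0.
  by rewrite addnS (le_trans (decT _)).
have geT n : x <= T n.
  rewrite -(cvg_lim _ hcv)//; apply: limr_le; first by apply/cvg_ex; exists x.
  exists n => // m /= /subnKC <-; apply: le_trans (decTm n (m - n)%N).
  by rewrite /T lerDl invr_ge0 ltW// cexp_gt0.
have ltT n : x < T n.
  have [q hq hdq] : exists2 q, (n < q)%N & d q != c.-1.
    apply/not_exists2P => h; apply: hne; exists n.+1 => // q /= nq.
    by have [//|/negP] := h q; rewrite negbK => /eqP.
  case: q hq hdq => // q; rewrite ltnS => nq hdq.
  apply: le_lt_trans (geT q.+1) _.
  apply: lt_le_trans (_ : T q <= _).
    rewrite -subr_gt0 TS mulr_gt0// ?invr_gt0 ?cexp_gt0//.
    have := hd q.+1 isT => hlt.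
    have : (d q.+1 + 2 <= c)%N by lia.
    by rewrite -(ler_nat R) natrD; lra.
  by rewrite -(subnKC nq) decTm.
have flN n : cfloor c n x = N n.
  apply/cintP'; rewrite -SN leS/=.
  by apply: (lt_le_trans (ltT n)); rewrite /T SN mulrDl mul1r.
case: p => // p _; rewrite /cdigit flN /= modzMDl modz_small//.
by rewrite lez_nat ltz_nat/= hd.
Qed.

Lemma digitsE x p : (0 < p)%N -> digits c x p = cdigit c p x.
Proof.
move=> p0; rewrite /digits; case: xgetP => [d _ [x0]|h].
  by move=> /is_expansion_uniq; apply.
by have := h (cdigit c ^~ x); case; exists (cfloor c 0 x); exact: is_expansion_cdigit.
Qed.

End Digits.

(** * Dirichlet's theorem *)

Section Dirichlet.
Context (R : realType).
Implicit Types (y : R) (N Q q : nat) (p : int).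

(** Pigeonhole: the [N + 1] fractional parts of [a y], [0 <= a <= N], fall into [N] boxes of length
    [1 / N]. *)
Lemma dirichlet y N : (0 < N)%N -> exists q p,
  [/\ (0 < q)%N, (q <= N)%N & `|q%:R * y - p%:~R| < N%:R^-1].
Proof.
case: N => // N _.
pose fr (a : nat) : R := a%:R * y - (Num.floor (a%:R * y))%:~R.
have fr_itv a : 0 <= fr a < 1.
  by have := floor_itv (a%:R * y); rewrite intrD /fr => /andP[? ?]; apply/andP; split; lra.
have N0 : 0 < N.+1%:R :> R by rewrite ltr0n.
have frN a : 0 <= N.+1%:R * fr a.
  by rewrite mulr_ge0// ?ler0n//; case/andP: (fr_itv a).
have lt a : (Num.truncn (N.+1%:R * fr a) < N.+1)%N.
  rewrite truncn_lt_nat//; have /andP[_ h] := fr_itv a.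
  by rewrite -[ltRHS]mulr1 ltr_pM2l.
pose f (a : 'I_N.+2) : 'I_N.+1 := Ordinal (lt a).
have /injectivePn[a [b ab fab]] : ~~ injectiveb f.
  apply/negP => /injectiveP /leq_card; rewrite !card_ord; lia.
wlog lt_ab : a b ab fab / (a < b)%N.
  move=> H; have [h|h|h] := ltngtP a b; first exact: (H a b).
    by apply: (H b a) => //; rewrite eq_sym.
  by move/eqP: ab; case; exact/val_inj.
exists (b - a)%N, (Num.floor (b%:R * y) - Num.floor (a%:R * y)).
split; [lia | by have := ltn_ord b; lia | ].
have := truncn_itv (frN a); have := truncn_itv (frN b).
have /= -> := congr1 (val : 'I_N.+1 -> nat) fab.
set M := Num.truncn _; rewrite -[M.+1%:R]natr1 => /andP[b1 b2] /andP[a1 a2].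
rewrite natrB 1?ltnW// intrB.
have -> : (b%:R - a%:R) * y - ((Num.floor (b%:R * y))%:~R - (Num.floor (a%:R * y))%:~R)
   = fr b - fr a by rewrite /fr; ring.
rewrite -(ltr_pM2l N0) mulfV ?lt0r_neq0// -[X in X * _](ger0_norm (ltW N0)) -normrM.
by rewrite ltr_norml; apply/andP; split; lra.
Qed.

Definition irrational_num y := forall p q, (0 < q)%N -> y != p%:~R / q%:R.

(** Only finitely many denominators are involved, and for each of them the distance of [q y] to the
    integers is positive. *)
Lemma irrational_dist y Q : irrational_num y -> exists2 d : R, 0 < d &
  forall q p, (0 < q <= Q)%N -> d <= `|q%:R * y - p%:~R|.
Proof.
move=> hy; elim: Q => [|Q [d d0 IH]]; first by exists 1 => // q p; lia.
set z := Q.+1%:R * y; pose e := Num.min (z - (Num.floor z)%:~R) ((Num.floor z)%:~R + 1 - z).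
have := floor_itv z; rewrite intrD => /andP[z1 z2].
have z3 : z != (Num.floor z)%:~R.
  apply/negP => /eqP h; have := hy (Num.floor z) Q.+1 isT.
  by rewrite -h /z mulrAC mulfV ?mul1r ?eqxx// pnatr_eq0.
exists (Num.min d e).
  rewrite lt_min d0 lt_min !subr_gt0 z2 andbT.
  by rewrite lt_neqAle eq_sym z3.
move=> q p /andP[q0]; rewrite leq_eqVlt => /orP[/eqP->|qQ]; last first.
  by rewrite ge_min IH//; lia.
rewrite ge_min; apply/orP; right; rewrite -/z /e ge_min.
have [h|h] := leP p (Num.floor z).
  have : p%:~R <= (Num.floor z)%:~R :> R by rewrite ler_int.
  by move=> h1; apply/orP; left; rewrite ger0_norm; lra.
have : (Num.floor z + 1)%:~R <= p%:~R :> R by rewrite ler_int; lia.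
rewrite intrD => h1; apply/orP; right; rewrite ler0_norm; lra.
Qed.

(** Once [1 / N] is below the distance [d] valid for denominators up to [Q], the reduced fraction
    must have a denominator above [Q], since dividing by the gcd does not increase [|q y - p|]. *)
Lemma dirichlet_coprime y Q : irrational_num y -> exists p q,
  [/\ (Q < q)%N, coprime `|p|%N q & `|y - p%:~R / q%:R| < q%:R ^- 2].
Proof.
move=> hy; have [d d0 hd] := irrational_dist Q hy.
pose N := (Num.truncn (d^-1)).+1.
have hN : N%:R^-1 < d.
  by rewrite invf_plt ?posrE ?ltr0n// truncnS_gt.
have [q [p [q0 qN hqp]]] := @dirichlet y N isT.
pose g := gcdn `|p| q; have g0 : (0 < g)%N by rewrite gcdn_gt0 q0 orbT.
pose q' := (q %/ g)%N; pose p' : int := sgz p * (`|p| %/ g)%N.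
have eq : q = (q' * g)%N by rewrite divnK// dvdn_gcdr.
have ep : p = p' * g.
  by rewrite /p' -mulrA -PoszM divnK ?dvdn_gcdl// abszE; case: (sgzP p) => h; lia.
have q'0 : (0 < q')%N by rewrite divn_gt0// dvdn_leq// dvdn_gcdr.
have q'R : 0 < q'%:R :> R by rewrite ltr0n.
have gR : 1 <= g%:R :> R by rewrite ler1n.
have h : `|q'%:R * y - p'%:~R| < N%:R^-1.
  apply: le_lt_trans hqp; rewrite eq ep natrM intrM.
  have -> : q'%:R * g%:R * y - p'%:~R * (g%:Z)%:~R = (q'%:R * y - p'%:~R) * g%:R :> R.
    by rewrite -pmulrn; ring.
  by rewrite normrM [`|g%:R|]ger0_norm// ler_peMr.
exists p', q'; split.
- rewrite ltnNge; apply/negP => q'Q.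
  have := hd q' p'; rewrite q'0 q'Q => /(_ isT) h2.
  by have := lt_trans h hN; rewrite ltNge h2.
- rewrite /p' abszM; have [p0|p0] := eqVneq p 0.
    by rewrite p0 /= div0n /coprime muln0 gcd0n /q' /g p0 gcd0n divnn q0.
  rewrite (_ : `|sgz p|%N = 1%N) ?mul1n; last by move: p0; case: (sgzP p).
  rewrite /coprime -(eqn_pmul2l g0).
  by rewrite muln_gcdr muln1 ![(g * _)%N]mulnC !divnK ?dvdn_gcdl ?dvdn_gcdr.
- have -> : y - p'%:~R / q'%:R = (q'%:R * y - p'%:~R) / q'%:R.
    by field; rewrite lt0r_neq0.
  rewrite normrM [`|_^-1|]ger0_norm ?invr_ge0 ?ler0n//.
  rewrite ltr_pdivrMr// expr2 invfM -mulrA mulVf ?lt0r_neq0// mulr1.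
  apply: (lt_le_trans h); rewrite lef_pV2 ?posrE ?ltr0n// ler_nat.
  by apply: leq_trans qN; exact: leq_div.
Qed.

End Dirichlet.

(** * The greedy digit sequence *)

Section GreedyPath.
Context (R : realType) (c : nat) (pi_ : 'I_c -> R).
Hypothesis pi_itv : forall b, 0 < pi_ b < 1.
Hypothesis pi_sum1 : \sum_(b < c) pi_ b = 1.
Implicit Types (s : seq 'I_c) (n : nat).

Let pi_gt0 b : 0 < pi_ b. Proof. by case/andP: (pi_itv b). Qed.

Definition bernoulli_mass s : R := \prod_(b <- s) pi_ b.

Definition freq_dev s : R :=
  \sum_(b < c) ((count_mem b s)%:R - (size s)%:R * pi_ b) ^+ 2.

Lemma bernoulli_mass_gt0 s : 0 < bernoulli_mass s.
Proof. by apply: prodr_gt0. Qed.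

Lemma bernoulli_mass_cons b s :
  bernoulli_mass (b :: s) = pi_ b * bernoulli_mass s.
Proof. by rewrite /bernoulli_mass big_cons. Qed.

Lemma freq_dev_ge0 s : 0 <= freq_dev s.
Proof. by apply: sumr_ge0 => b _; exact: sqr_ge0. Qed.

(** A random digit changes the deviation of the count of [a] by a centred variable of variance at
    most [pi_ a], and these bounds sum to 1. *)
Lemma freq_dev_mean s :
  \sum_b pi_ b * freq_dev (b :: s) <= freq_dev s + 1.
Proof.
rewrite /freq_dev; under eq_bigr do rewrite mulr_sumr.
rewrite exchange_big/= -[X in _ <= _ + X]pi_sum1 -big_split/=.
apply: ler_sum => a _.
set e := (count_mem a s)%:R - (size s)%:R * pi_ a.
have -> : \sum_(i < c) pi_ i * (((i == a) + count_mem a s)%:R -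
    (size s).+1%:R * pi_ a) ^+ 2 =
    \sum_(i < c) (pi_ i * (e - pi_ a) ^+ 2 +
      (i == a)%:R * pi_ i * (1 + 2 * (e - pi_ a))).
  apply: eq_bigr => i _; rewrite natrD -natr1 /e.
  by case: (i == a) => /=; ring.
rewrite big_split/= -!mulr_suml pi_sum1.
have -> : \sum_(i < c) (i == a)%:R * pi_ i = pi_ a.
  rewrite (bigD1 a)//= eqxx mul1r big1 ?addr0// => i /negPf ->.
  by rewrite mul0r.
have := pi_gt0 a; nra.
Qed.

Variables (V : seq 'I_c -> R) (B : R).
Hypothesis V_ge0 : forall s, 0 <= V s.
Hypothesis B_gt0 : 0 < B.

(** The shift by 25 makes [root 0 = 5], so that the empty word has potential below
    [1/2 + 2/5 < 1]. *)
Let root n : R := Num.sqrt (n + 25)%:R.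

(* A supermartingale for the Bernoulli measure: the expectation of [freq_dev]
   grows by at most 1 at each step, which the last term compensates. *)
Definition potential s : R :=
  V s / (2 * B * bernoulli_mass s) + freq_dev s / root (size s) ^+ 3
  + 2 / root (size s).

Let root_gt0 n : 0 < root n. Proof. by rewrite sqrtr_gt0 ltr0n addnS. Qed.

Let root_sqr n : root n ^+ 2 = (n + 25)%:R.
Proof. by rewrite sqr_sqrtr// ler0n. Qed.

(** With [a], [b] the two roots, [b ^ 2 = a ^ 2 + 1]; after clearing denominators and squaring, the
    sides differ by [3 a ^ 2 + 4]. *)
Let root_step n : (root n.+1 ^+ 3)^-1 + 2 / root n.+1 <= 2 / root n.
Proof.
have := root_sqr n; have := root_sqr n.+1; rewrite addSn -natr1 => hb ha.
have a0 := root_gt0 n; have b0 := root_gt0 n.+1.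
set a := root n in a0 ha *; set b := root n.+1 in hb b0 *.
rewrite -ha in hb.
have ab : a <= b by rewrite -ler_sqr ?nnegrE ?ltW// hb; lra.
have -> : (b ^+ 3)^-1 + 2 / b = (1 + 2 * b ^+ 2) / b ^+ 3 by field; rewrite lt0r_neq0.
rewrite ler_pdivrMr ?exprn_gt0// mulrAC ler_pdivlMr//.
rewrite -ler_sqr ?nnegrE ?mulr_ge0 ?addr_ge0 ?exprn_ge0 ?mulr_ge0 ?sqr_ge0 ?(ltW a0) ?(ltW b0)//.
have -> : b ^+ 3 = b * (a ^+ 2 + 1) by rewrite exprS hb.
rewrite -subr_ge0 hb.
have -> : (2 * (b * (a ^+ 2 + 1))) ^+ 2 - ((1 + 2 * (a ^+ 2 + 1)) * a) ^+ 2 =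
  4 * b ^+ 2 * (a ^+ 2 + 1) ^+ 2 - (1 + 2 * (a ^+ 2 + 1)) ^+ 2 * a ^+ 2 by ring.
rewrite hb; have -> : 4 * (a ^+ 2 + 1) * (a ^+ 2 + 1) ^+ 2 -
  (1 + 2 * (a ^+ 2 + 1)) ^+ 2 * a ^+ 2 = 3 * a ^+ 2 + 4 by ring.
by have := sqr_ge0 a; lra.
Qed.

(** In the mean with weights [pi_ b] the weight cancels the new factor of the mass, so the first
    term does not grow; [root_step] pays for the growth of the second. Some digit is no worse than
    the mean. *)
Lemma potential_step s : \sum_b V (b :: s) <= V s ->
  exists b, potential (b :: s) <= potential s.
Proof.
move=> hV.
have [b0 _] : exists b0 : 'I_c, True.
  apply: contrapT => h; have := pi_sum1; rewrite big1 => [|i _].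
    by move/eqP; rewrite eq_sym oner_eq0.
  by case: h; exists i.
apply: contrapT => /forallNP h.
have {}h b : potential s < potential (b :: s) by rewrite ltNge; exact/negP.
have : 0 < \sum_b pi_ b * (potential (b :: s) - potential s).
  rewrite (bigD1 b0)//= ltr_wpDr//.
    by apply: sumr_ge0 => b _; rewrite mulr_ge0 ?subr_ge0 ?ltW.
  by rewrite mulr_gt0// subr_gt0.
under eq_bigr do rewrite mulrBr.
rewrite big_split/= sumrN -mulr_suml.
rewrite (_ : \sum_b pi_ b * _ = (\sum_b V (b :: s)) / (2 * B * bernoulli_mass s) +
  (\sum_b pi_ b * freq_dev (b :: s)) / root (size s).+1 ^+ 3 +
  2 / root (size s).+1); last first.
  rewrite !mulr_suml -big_split/= -[X in _ + X]mul1r.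
  rewrite -[X in _ + X * (2 / _)]pi_sum1 mulr_suml -big_split/=; apply: eq_bigr => b _.
  rewrite /potential bernoulli_mass_cons /=.
  have := pi_gt0 b; have := bernoulli_mass_gt0 s; have := root_gt0 (size s).+1.
  by move=> ? ? ?; field; rewrite !lt0r_neq0.
apply/negP; rewrite -leNgt pi_sum1 mul1r /potential.
have i3 : 0 < root (size s).+1 ^- 3 by rewrite invr_gt0 exprn_gt0.
have i3' : root (size s).+1 ^- 3 <= root (size s) ^- 3.
  rewrite lef_pV2 ?posrE ?exprn_gt0//.
  rewrite lerXn2r ?nnegrE ?(ltW (root_gt0 _))//.
  by rewrite ler_sqrt ?ltr0n ?addSn// ler_nat.
have BM : 0 < (2 * B * bernoulli_mass s)^-1.
  by rewrite invr_gt0 !mulr_gt0// bernoulli_mass_gt0.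
have := root_step (size s).
have := freq_dev_mean s; have := freq_dev_ge0 s.
set F := freq_dev s; set F' := \sum_b _ * _.
set V' := \sum_b _; set r1 := root _ ^- 3; set r2 := root _ ^- 3.
move=> h1 h2 h3.
have q1 : V' / (2 * B * bernoulli_mass s) <= V s / (2 * B * bernoulli_mass s).
  by rewrite ler_pM2r.
have q2 : F' * r1 <= F * r2 + r1.
  apply: le_trans (_ : (F + 1) * r1 <= _); first by rewrite ler_pM2r.
  by rewrite mulrDl mul1r lerD2r ler_wpM2l.
lra.
Qed.

(** Words carry their last digit at the head, so that appending a digit is a cons. *)
Fixpoint prefix_of (d : nat -> 'I_c) n : seq 'I_c :=
  if n is m.+1 then d m :: prefix_of d m else [::].

Lemma size_prefix_of d n : size (prefix_of d n) = n.
Proof. by elim: n => //= n ->. Qed.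

Lemma potential_path : V [::] < B ->
  (forall s, potential s < 1 -> \sum_b V (b :: s) <= V s) ->
  exists d, forall n, potential (prefix_of d n) < 1.
Proof.
move=> VB hV.
have b0 : 'I_c.
  have : (0 < c)%N; last by case: (c) => // m _; exact: ord0.
  rewrite lt0n; apply/eqP => c0; move: pi_sum1.
  rewrite big1 => [|i _]; last by have := ltn_ord i; lia.
  by move/eqP; rewrite eq_sym oner_eq0.
have /choice[f hf] : forall s, exists b, potential s < 1 -> potential (b :: s) < 1.
  move=> s; have [h|h] := boolP (potential s < 1); last by exists b0.
  by have [b hb] := potential_step (hV _ h); exists b => _; exact: le_lt_trans h.
pose st n := iter n (fun s => f s :: s) [::].
exists (fun n => f (st n)) => n.
have -> : prefix_of (fun n => f (st n)) n = st n by elim: n => //= n ->.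
elim: n => [|n IH]; last exact: hf.
rewrite /st/= /potential /= /bernoulli_mass big_nil /freq_dev.
rewrite big1 ?mul0r => [|b _]; last by rewrite mul0r subrr expr0n.
have -> : root 0 = 5.
  rewrite /root add0n (_ : 25%:R = 5 ^+ 2); first by rewrite sqrtr_sqr ger0_norm.
  by rewrite -natrX.
rewrite mulr1 addr0.
have : V [::] / (2 * B) < 2^-1.
  by rewrite ltr_pdivrMr ?mulr_gt0// mulrA mulVf// mul1r.
lra.
Qed.

Let potential_terms s : [/\ 0 <= V s / (2 * B * bernoulli_mass s),
  0 <= freq_dev s / root (size s) ^+ 3 & 0 <= 2 / root (size s)].
Proof.
split; apply: divr_ge0 => //.
- by rewrite !mulr_ge0// ltW// bernoulli_mass_gt0.
- exact: freq_dev_ge0.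
- by rewrite exprn_ge0// ltW.
- exact: ltW.
Qed.

Lemma potential_cost s : potential s < 1 -> V s < 2 * B * bernoulli_mass s.
Proof.
have [h1 h2 h3] := potential_terms s; rewrite /potential => h.
rewrite -[ltRHS]mul1r -ltr_pdivrMr; last by rewrite !mulr_gt0// bernoulli_mass_gt0.
lra.
Qed.

(** Each term of the potential is nonnegative, hence below 1. So [freq_dev s] is below the power
    [3/2] of [size s + 25], and a single deviation is at most its square root. *)
Lemma potential_freq s b : potential s < 1 ->
  `|(count_mem b s)%:R - (size s)%:R * pi_ b| <= (size s + 25)%:R `^ (3 / 4).
Proof.
have [h1 h2 h3] := potential_terms s; rewrite /potential => h.
have {h1 h2 h3} : freq_dev s < root (size s) ^+ 3.
  by rewrite -[ltRHS]mul1r -ltr_pdivrMr ?exprn_gt0//; lra.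
have -> : root (size s) ^+ 3 = ((size s + 25)%:R `^ (3 / 4)) ^+ 2.
  rewrite /root; have : 0 <= (size s + 25)%:R :> R by exact: ler0n.
  move: (_ + 25)%:R => x x0; rewrite -(powR12_sqrt x0).
  rewrite -[LHS]powR_mulrn; last exact: powR_ge0.
  rewrite -[RHS]powR_mulrn; last exact: powR_ge0.
  rewrite -!powRrM.
  by congr (_ `^ _); field.
rewrite -[in X in _ -> X]ler_sqr ?nnegrE ?powR_ge0// => /ltW.
apply: le_trans; rewrite real_normK ?num_real// /freq_dev (bigD1 b)//=.
by rewrite lerDl sumr_ge0// => i _; exact: sqr_ge0.
Qed.

End GreedyPath.

(** * Entropy and the mass of words with balanced digits *)

Section EntropyBound.
Context (R : realType) (c : nat) (pi_ : 'I_c -> R).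
Hypothesis pi_itv : forall b, 0 < pi_ b < 1.
Hypothesis pi_sum1 : \sum_(b < c) pi_ b = 1.
Let pi_gt0 b : 0 < pi_ b. Proof. by case/andP: (pi_itv b). Qed.

Definition nat_entropy : R := - \sum_(b < c) pi_ b * ln (pi_ b).

Lemma entropyE : entropy pi_ = nat_entropy / ln c%:R.
Proof.
rewrite /entropy /nat_entropy mulNr mulr_suml; congr (- _).
by apply: eq_bigr => b _; rewrite /logb mulrA.
Qed.

Lemma nat_entropy_ge0 : 0 <= nat_entropy.
Proof.
rewrite oppr_ge0; apply: sumr_le0 => b _.
rewrite mulr_ge0_le0 ?(ltW (pi_gt0 _))// ln_le0//.
by case/andP: (pi_itv b) => _ /ltW.
Qed.

(** Gibbs' inequality: [ln z <= z - 1] at [z = 1 / (c pi_b)], averaged with the weights [pi_b]. *)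
Lemma nat_entropy_le : (0 < c)%N -> nat_entropy <= ln c%:R.
Proof.
move=> c0; have cR : 0 < c%:R :> R by rewrite ltr0n.
rewrite -subr_le0 -[X in _ - X]mul1r -[X in _ - X * ln _]pi_sum1 mulr_suml -opprD -big_split/=.
rewrite oppr_le0.
have : \sum_(b < c) (pi_ b - c%:R^-1) <= \sum_(b < c) (pi_ b * ln (pi_ b) + pi_ b * ln c%:R).
  apply: ler_sum => b _; have p0 := pi_gt0 b.
  have := @ln_sublinear R ((pi_ b * c%:R)^-1).
  rewrite invr_gt0 mulr_gt0// => /(_ isT).
  have := @le_ln1Dx R ((pi_ b * c%:R)^-1 - 1).
  rewrite ltrBrDl subrr invr_gt0 mulr_gt0// => /(_ isT).
  rewrite addrC subrK lnV ?posrE ?mulr_gt0// lnM ?posrE// => h _.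
  have : pi_ b * (- (ln (pi_ b) + ln c%:R)) <= pi_ b * ((pi_ b * c%:R)^-1 - 1).
    by rewrite ler_pM2l.
  have -> : pi_ b * ((pi_ b * c%:R)^-1 - 1) = c%:R^-1 - pi_ b.
    by field; rewrite !lt0r_neq0.
  by move=> ?; lra.
move=> h; apply: le_trans h; rewrite big_split/= pi_sum1 sumrN sumr_const card_ord.
by rewrite -[_ *+ c]mulr_natr mulVf ?lt0r_neq0// subrr.
Qed.

(** The left side is the sum of the counts times [ln (pi_ b)]; replacing a count by its expected
    value costs at most [e |ln (pi_ b)|]. *)
Lemma ln_bernoulli_mass s (e : R) :
  (forall b, `|(count_mem b s)%:R - (size s)%:R * pi_ b| <= e) ->
  ln (bernoulli_mass pi_ s) <=
    - ((size s)%:R * nat_entropy) + (\sum_b `|ln (pi_ b)|) * e.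
Proof.
move=> he.
have -> : ln (bernoulli_mass pi_ s) = \sum_b (count_mem b s)%:R * ln (pi_ b).
  elim: s {he} => [|a s IH].
    by rewrite /bernoulli_mass big_nil ln1 big1// => b _; rewrite mul0r.
  rewrite /bernoulli_mass big_cons lnM ?posrE ?prodr_gt0// IH.
  under [RHS]eq_bigr do rewrite /= natrD mulrDl.
  rewrite big_split/=; congr (_ + _).
  rewrite (bigD1 a)//= eqxx mul1r big1 ?addr0// => i.
  by rewrite eq_sym => /negPf ->; rewrite mul0r.
rewrite /nat_entropy mulrN opprK mulr_sumr mulr_suml -big_split/=.
apply: ler_sum => b _; rewrite -lerBlDl.
have -> : (count_mem b s)%:R * ln (pi_ b) - (size s)%:R * (pi_ b * ln (pi_ b))
  = ((count_mem b s)%:R - (size s)%:R * pi_ b) * ln (pi_ b) by ring.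
rewrite (le_trans (ler_norm _))// normrM mulrC ler_wpM2l//.
Qed.

End EntropyBound.

(** * Points with prescribed digits *)

Section CadicPath.
Context (R : realType) (c : nat) (hc : (2 <= c)%N).
Implicit Types (x y : R) (i j n m p : nat) (k : int).

Let cexp0 i : 0 < c%:R ^+ i :> R. Proof. exact: cexp_gt0. Qed.

Lemma cint_child i k x (b : 'I_c) : cint c i.+1 (k * c + b) x -> cint c i k x.
Proof.
rewrite /cint/= cfloorS// => h; have := cdigit_lt hc i.+1 x; have := ltn_ord b.
move: (cdigit _ _ _) (cfloor c i x) h => d k' h hb hd.
nia.
Qed.

(** An interval of level [i] splits into [c ^ m] intervals of level [i + m]; a nonzero digit in
    between rules out the first of them. *)
Lemma cfloor_ge_lead i k y m : cint c i k y ->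
  (k * (c ^ m)%N <= cfloor c (i + m) y)%R /\
  ((exists2 p, (i < p <= i + m)%N & cdigit c p y != 0%N) ->
   k * (c ^ m)%N + 1 <= cfloor c (i + m) y)%R.
Proof.
move=> hy; elim: m => [|m [IH1 IH2]].
  by rewrite addn0 expn0 mulr1 hy; split=> // -[p]; lia.
rewrite addnS cfloorS// expnS PoszM [c%:Z * _]mulrC mulrA.
split; first by nia.
move=> [p hp hd]; have [pim|pim] := eqVneq p (i + m).+1.
  by rewrite -pim; nia.
by have := IH2 (ex_intro2 _ _ p _ hd); rewrite (_ : (i < p <= i + m)%N); [nia|lia].
Qed.

(** The mirror image: a digit other than [c.-1] rules out the last subinterval. *)
Lemma cfloor_le_lead i k y m : cint c i k y ->
  (cfloor c (i + m) y + 1 <= (k + 1) * (c ^ m)%N)%R /\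
  ((exists2 p, (i < p <= i + m)%N & cdigit c p y != c.-1) ->
   cfloor c (i + m) y + 2 <= (k + 1) * (c ^ m)%N)%R.
Proof.
move=> hy; elim: m => [|m [IH1 IH2]].
  by rewrite addn0 expn0 mulr1 hy; split=> // -[p]; lia.
rewrite addnS cfloorS// expnS PoszM [c%:Z * _]mulrC mulrA.
have hd := cdigit_lt hc (i + m).+1 y.
split; first by nia.
move=> [p hp hdp]; have [pim|pim] := eqVneq p (i + m).+1.
  by move: hdp hd; rewrite -pim; nia.
by have := IH2 (ex_intro2 _ _ p _ hdp); rewrite (_ : (i < p <= i + m)%N); [nia|lia].
Qed.

(* A digit that is not 0 (resp. not [c.-1]) soon after position [i] keeps [y]
   away from the left (resp. right) end of its interval of level [i]. *)
Lemma cint_ball i k y m x : cint c i k y ->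
  (exists2 p, (i < p <= i + m)%N & cdigit c p y != 0%N) ->
  (exists2 p, (i < p <= i + m)%N & cdigit c p y != c.-1) ->
  `|x - y| < c%:R ^- (i + m) -> k%:~R / c%:R ^+ i < x < (k%:~R + 1) / c%:R ^+ i.
Proof.
move=> hy /(cfloor_ge_lead m hy).2 h1 /(cfloor_le_lead m hy).2 h2.
have /andP[h3 h4] := cfloor_itv c (i + m) y.
rewrite -[_ ^- _]mul1r ltr_pdivlMr// => h5.
set F := cfloor c (i + m) y in h1 h2 h3 h4.
have cE : ((c ^ m)%N%:Z)%:~R = c%:R ^+ m :> R by rewrite -pmulrn natrX.
have h1' : k%:~R * c%:R ^+ m + 1 <= F%:~R :> R.
  by rewrite -cE -intrM -[1]/(1%:~R) -intrD ler_int.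
have h2' : F%:~R + 2 <= (k%:~R + 1) * c%:R ^+ m :> R.
  by rewrite -cE -[1]/(1%:~R) -[2]/(2%:~R) -!intrD -intrM ler_int.
have : `|c%:R ^+ (i + m) * x - c%:R ^+ (i + m) * y| < 1.
  by rewrite -mulrBr normrM ger0_norm ?(ltW (cexp0 _))// mulrC.
rewrite ltr_norml ltr_pdivrMr// ltr_pdivlMr// => /andP[h6 h7].
move: h3 h4 h6 h7; rewrite exprD => h3 h4 h6 h7.
have hm := cexp0 m.
by apply/andP; split; rewrite -(ltr_pM2r hm); nra.
Qed.

Lemma cint_dist i k x z : cint c i k x ->
  k%:~R / c%:R ^+ i <= z <= (k%:~R + 1) / c%:R ^+ i -> `|z - x| <= c%:R ^- i.
Proof.
move=> /(cintP' hc) /andP[y1 y2] /andP[z1 z2].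
move: z2 y2; rewrite mulrDl mul1r ler_norml => z2 y2.
by apply/andP; split; lra.
Qed.

Variables (i1 : nat) (u : int) (d : nat -> 'I_c).

(** The index of the interval reached by reading the digits of [s], last digit at the head, inside
    the interval of level [i1] and index [u]. *)
Fixpoint cindex (s : seq 'I_c) : int :=
  if s is b :: s' then cindex s' * c + b else u.

Let K n := cindex (prefix_of d n).

(** The point is the supremum of the left ends. It stays below every right end because a later digit
    other than [c.-1] strictly lowers the right ends. *)
Lemma cint_path : (forall n, exists2 m, (n <= m)%N & d m != c.-1 :> nat) ->
  exists y, forall n, cint c (i1 + n) (K n) y.
Proof.
move=> hd.
pose L n : R := (K n)%:~R / c%:R ^+ (i1 + n).
pose T n : R := ((K n)%:~R + 1) / c%:R ^+ (i1 + n).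
have LS n : L n.+1 = L n + (d n)%:R / c%:R ^+ (i1 + n).+1.
  rewrite /L /K addnS /= intrD intrM exprS; have := cexp0 (i1 + n) => ?.
  by rewrite -!pmulrn; field; rewrite !lt0r_neq0// ltr0n; lia.
have TS n : T n - T n.+1 = (c%:R - (d n)%:R - 1) / c%:R ^+ (i1 + n).+1.
  rewrite /T /K addnS /= intrD intrM exprS; have := cexp0 (i1 + n) => ?.
  by rewrite -!pmulrn; field; rewrite !lt0r_neq0// ltr0n; lia.
have LT n : L n <= T n by rewrite /T mulrDl lerDl divr_ge0// ltW.
have Lm n m : L n <= L (n + m)%N.
  elim: m => [|m IH]; first by rewrite addn0.
  by rewrite addnS LS (le_trans IH)// lerDl divr_ge0// ltW.
have Tdec n : T n.+1 <= T n.
  rewrite -subr_ge0 TS divr_ge0 ?(ltW (cexp0 _))//.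
  by have := ltn_ord (d n); rewrite -(ler_nat R) -natr1; lra.
have Tm n m : T (n + m)%N <= T n.
  elim: m => [|m IH]; first by rewrite addn0.
  by rewrite addnS (le_trans (Tdec _)).
have LTnm n m : L n <= T m.
  have [nm|nm] := leqP n m.
    by rewrite (le_trans _ (LT m))// -(subnKC nm).
  by rewrite (le_trans (LT n))// -(subnKC (ltnW nm)).
have hs : has_sup (range L).
  by split; [exists (L 0%N); exists 0%N|exists (T 0%N) => _ [n _ <-]].
pose y := sup (range L).
have Ly n : L n <= y by apply: ub_le_sup; [exact: hs.2|exists n].
have yT n : y <= T n by apply: ge_sup; [exact: hs.1|move=> _ [m _ <-]].
exists y => n; apply/(cintP' hc); rewrite Ly/=.
have [m nm hm] := hd n.
apply: (@lt_le_trans _ _ (T m)); last by rewrite -(subnKC nm).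
apply: le_lt_trans (yT m.+1) _.
rewrite -subr_gt0 TS divr_gt0//.
have : (d m + 2 <= c)%N by have := ltn_ord (d m); lia.
by rewrite -(ler_nat R) natrD; lra.
Qed.

Lemma cint_path_prefix n m x : (m <= n)%N -> cint c (i1 + n) (K n) x ->
  cint c (i1 + m) (K m) x.
Proof.
move=> /subnKC <-; elim: (n - m)%N => [|j IH]; first by rewrite addn0.
by rewrite !addnS => h; apply: IH; exact: cint_child h.
Qed.

Lemma cdigit_path n m x : (m < n)%N -> cint c (i1 + n) (K n) x ->
  cdigit c (i1 + m).+1 x = d m.
Proof.
move=> mn h; have h1 := cint_path_prefix mn h.
have := cint_path_prefix (ltnW mn) h.
move: h1; rewrite addnS /cint /K/= cfloorS// => h1 h2.
by move: h1; rewrite h2 => /addrI [].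
Qed.

Lemma count_cdigit_path n x (b : 'I_c) : cint c (i1 + n) (K n) x ->
  count (fun p => cdigit c p x == b) (iota i1.+1 n) = count_mem b (prefix_of d n).
Proof.
elim: n => // n IH h.
rewrite -[X in iota _ X]addn1 iotaD count_cat /= addn0 addSn (cdigit_path (ltnSn n) h).
by rewrite (IH (cint_path_prefix (leqnSn n) h)) addnC.
Qed.

(** Only the digits at positions [i1 + 1] to [i1 + n] are controlled; each of the others changes the
    deviation by at most 1. *)
Lemma digit_freq_bound n m x (b : 'I_c) (q E : R) :
  cint c (i1 + n) (K n) x -> (i1 + n <= m)%N -> 0 <= q <= 1 ->
  `|(count_mem b (prefix_of d n))%:R - n%:R * q| <= E ->
  `|(count (fun p => digits c x p == b) (iota 1 m))%:R - m%:R * q|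
    <= i1%:R + E + (m - (i1 + n))%:R.
Proof.
move=> hx nm /andP[q0 q1] hE.
rewrite (@eq_in_count _ _ (fun p => cdigit c p x == b)); last first.
  by move=> p; rewrite mem_iota => /andP[p0 _]; rewrite digitsE.
have em : m = (i1 + (n + (m - (i1 + n))))%N by lia.
set j := (m - _)%N in em *.
rewrite em !iotaD !count_cat add1n (count_cdigit_path b hx) !natrD.
 set c1 := count _ _; set c2 := count _ (iota _ j).
have h1 : c1%:R <= i1%:R :> R by rewrite ler_nat (leq_trans (count_size _ _))// size_iota.
have h2 : c2%:R <= j%:R :> R by rewrite ler_nat (leq_trans (count_size _ _))// size_iota.
have h3 : 0 <= c1%:R :> R by [].
have h4 : 0 <= c2%:R :> R by [].
have h5 (a : nat) : 0 <= a%:R * q <= a%:R.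
  by rewrite mulr_ge0//= ler_piMr.
clearbody c1 c2 j. have /andP[? ?] := h5 i1; have /andP[? ?] := h5 j.
move: hE; rewrite !mulrDl !ler_norml => /andP[? ?].
by apply/andP; split; lra.
Qed.

Lemma count_prefix_const n s (b : 'I_c) :
  (forall m, (n <= m < n + s)%N -> d m = b) ->
  count_mem b (prefix_of d (n + s)) = (count_mem b (prefix_of d n) + s)%N.
Proof.
elim: s => [|s IH] h; first by rewrite !addn0.
rewrite addnS /= h; last by rewrite leq_addr addnS ltnSn.
rewrite eqxx IH ?add1n ?addnS// => m hm; apply: h; lia.
Qed.

End CadicPath.

(** * Comparison with the gauge function *)

Section Growth.
Context (R : realType).
Implicit Types (a b K l th : R).

Lemma powR_growth a b K : a < b -> exists X : nat, forall n : nat,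
  (X <= n)%N -> K * n%:R `^ a <= n%:R `^ b.
Proof.
move=> ab; have ba : 0 < b - a by rewrite subr_gt0.
pose K' := `|K| + 1; have K'0 : 0 <= K' by rewrite addr_ge0.
exists (Num.truncn (K' `^ (b - a)^-1)).+1 => n hn.
have n0 : 0 < n%:R :> R by rewrite ltr0n; lia.
have hK : K' `^ (b - a)^-1 <= n%:R.
  by apply: (le_trans (ltW (truncnS_gt _))); rewrite ler_nat.
rewrite -[b](subrK a) powRD ?(gt_eqF n0) ?implybT// ler_wpM2r ?powR_ge0//.
have : (K' `^ (b - a)^-1) `^ (b - a) <= n%:R `^ (b - a).
  by apply: ge0_ler_powR; rewrite ?nnegrE ?powR_ge0 ?(ltW ba) ?(ltW n0).
rewrite -powRrM mulVf ?gt_eqF// powRr1//; apply: le_trans.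
by rewrite /K' (le_trans (ler_norm K))// lerDl.
Qed.

Lemma le1_powRn (n : nat) a : (0 < n)%N -> 0 <= a -> 1 <= n%:R `^ a :> R.
Proof. by move=> n0 a0; rewrite -[leLHS](powRr0 n%:R) ler_powR// ler1n. Qed.

Lemma powR_affine_growth a b K1 K2 (e : R) : 0 <= a -> a < b -> 0 < e ->
  exists X : nat, forall n : nat, (X <= n)%N ->
    K1 * n%:R `^ a + K2 <= e * n%:R `^ b.
Proof.
move=> a0 ab e0; have [X hX] := powR_growth ((K1 + `|K2|) / e) ab.
exists X.+1 => n hn; rewrite [e * _]mulrC -ler_pdivrMr//.
apply: (le_trans _ (hX n (ltnW hn))).
rewrite [leRHS]mulrAC ler_pM2r ?invr_gt0// mulrDl lerD2l.
apply: (le_trans (ler_norm _)); rewrite ler_peMr//.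
by apply: le1_powRn => //; lia.
Qed.

End Growth.

Section Gauge.
Context (R : realType).
Implicit Types (g h : R -> R) (a r eta : R).

Lemma gauge_prec_lt g h : (forall r, 0 < r -> 0 < h r) -> gauge_prec g h ->
  exists2 d : R, 0 < d & forall r, 0 < r < d -> h r < g r.
Proof.
move=> h0 [_ /cvgryPgt /(_ 1)[d /= d0 hd]].
exists d => // r /andP[r0 rd].
have := hd r; rewrite /= sub0r normrN gtr0_norm// => /(_ rd r0).
by rewrite ltr_pdivlMr ?mul1r// h0.
Qed.

Lemma h_gt0 a (f : R -> R) r : 0 < r -> 0 < h_ a f r.
Proof. by move=> r0; rewrite /h_ gt_eqF// powR_gt0. Qed.

(** The correction has exponent [eta + 7/8] in [- ln r]. This exceeds [3/4], the exponent of the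
    digit deviations, and is what absorbs them. *)
Lemma h_expR a eta r : 0 < r < 1 -> h_ a (fun r => 3 * f_ eta r) r =
  expR (- (a * - ln r) + 3 * (- ln r) `^ (eta - 8^-1 + 1) : R).
Proof.
move=> /andP[r0 r1]; rewrite /h_ gt_eqF// {1}/powR gt_eqF//; congr (expR _).
have L0 : 0 < - ln r by rewrite oppr_gt0 ln_lt0 ?r0.
rewrite powRD; last by rewrite (gt_eqF L0) implybT.
rewrite powRr1 ?(ltW L0)// /f_; ring.
Qed.

End Gauge.

Lemma ln_cinv (R : realType) (c i : nat) : (2 <= c)%N ->
  ln (c%:R ^- i : R) = - (i%:R * ln c%:R).
Proof.
move=> hc; have c0 : 0 < c%:R :> R by rewrite ltr0n ltnW.
by rewrite lnV ?posrE ?exprn_gt0// lnXn// mulr_natl.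
Qed.

Section CostBound.
Context (R : realType) (t : R) (ht : 1 <= t) (c : nat) (hc : (2 <= c)%N).
Context (H : R) (H0 : 0 <= H) (Hc : H <= ln c%:R).
Context (eta : R) (heta : 0 < eta < 8^-1) (g : R -> R).
Hypothesis hg : gauge_prec g (h_ (H / ln c%:R / t) (fun r => 3 * f_ eta r)).

Let lnc_gt0 : 0 < ln c%:R :> R.
Proof. by rewrite ln_gt0// ltr1n. Qed.

Let c_gt0 : 0 < c%:R :> R. Proof. by rewrite ltr0n; lia. Qed.

(** In the main application [mu] is the mass of a word of length [n] read from level [i1], [m] is
    about [2 log_c q] and [l] is the level of [q ^ (- 2 t)]. As [H <= ln c], the logarithm of the
    left side is at most [- m H + O(m ^ (3/4))]; that of the gauge is at least [- m H] plus a
    multiple of [m ^ th] with [th > 3/4], up to a constant. *)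
Lemma cost_bound (G : R) (i0 : nat) (K Lam : R) : 0 < G -> 0 <= Lam ->
  exists X : nat, forall (i1 n m l : nat) (mu : R), (X <= i1)%N ->
    (i1 + n <= m)%N -> (m - (i1 + n))%:R <= K * m%:R `^ (3 / 4) + 2 ->
    (m <= l)%N -> l%:R <= t * (m%:R + 1) + 1 ->
    0 < mu -> ln mu <= - (n%:R * H) + Lam * (n + 25)%:R `^ (3 / 4) ->
    2 * (G * c%:R ^+ i0 / c%:R ^+ i1) * mu < g (c%:R ^- l).
Proof.
move=> G0 Lam0; have lc0 := lnc_gt0; have Hlc := Hc; have hg0 := hg.
set lc := ln c%:R in lc0 Hlc hg0 *.
have [eta0 eta8] := andP heta.
pose th := eta - 8^-1 + 1.
(* The constant gathers the factor [2 G c ^ i0] and twice [2 * lc]: once for the rounding of [l],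
   once for the [+ 2] in the bound on [m - (i1 + n)]. *)
have [X1 hX1] : exists X : nat, forall n : nat, (X <= n)%N ->
    (K * lc + Lam) * n%:R `^ (3 / 4) + (ln 2 + ln G + i0%:R * lc + 4 * lc)
      <= (3 * lc `^ th) * n%:R `^ th.
  apply: powR_affine_growth; [lra|rewrite /th; lra|].
  by rewrite mulr_gt0// powR_gt0.
have [d d0 hd] := gauge_prec_lt (@h_gt0 R _ _) hg0.
have [X2 hX2] := cinv_lt hc d0.
exists (25 + X1 + X2)%N => i1 n m l mu hi1 nm hnm ml lt mu0 hmu.
have cn i : 0 < c%:R ^+ i :> R by exact: exprn_gt0.
have [l0 m25 mX lX] : [/\ 0 < l, n + 25 <= m, X1 <= m & X2 <= l]%N.
  by move: hi1 nm ml; clear; split; lia.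
have l1 : (1 < c%:R ^+ l :> R).
  by rewrite (exprn_egt1 _ (_ : 1 < c%:R)) ?ltr1n// -lt0n.
apply: (@le_lt_trans _ _ (h_ (H / lc / t) (fun r => 3 * f_ eta r) (c%:R ^- l))); last first.
  by apply: hd; rewrite invr_gt0 cn/= hX2.
have l01 : 0 < (c%:R ^- l : R) < 1 by rewrite invr_gt0 cn/= invf_lt1.
rewrite h_expR// (ln_cinv _ _ hc) opprK -/lc -/th.
have B0 : 0 < 2 * (G * c%:R ^+ i0 / c%:R ^+ i1) * mu.
  by rewrite !mulr_gt0// invr_gt0.
rewrite -[leLHS]lnK ?posrE// ler_expR.
rewrite !lnM ?posrE ?invr_gt0 ?mulr_gt0 ?invr_gt0// (ln_cinv _ _ hc) -/lc lnXn// -/lc -[lc *+ i0]mulr_natl.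
have e1 : (n + 25)%:R `^ (3 / 4) <= m%:R `^ (3 / 4) :> R.
  by apply: ge0_ler_powR; rewrite ?nnegrE ?ler0n ?ler_nat//; lra.
have {hX1} := hX1 m mX; rewrite -mulrA -powRM ?ler0n ?(ltW lc0)//.
have e2 : (lc * m%:R) `^ th <= (l%:R * lc) `^ th.
  rewrite [l%:R * _]mulrC; apply: ge0_ler_powR; rewrite ?nnegrE ?mulr_ge0 ?ler0n ?(ltW lc0)//.
    by rewrite /th; lra.
  by rewrite ler_pM2l// ler_nat.
have e3 : H / lc / t * (l%:R * lc) <= H * m%:R + 2 * lc.
  have -> : H / lc / t * (l%:R * lc) = H * (l%:R / t).
    by field; rewrite (gt_eqF lc0) gt_eqF// (lt_le_trans ltr01 ht).
  apply: le_trans (_ : H * (m%:R + 2) <= _); last first.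
    by rewrite mulrDr lerD2l mulrC ler_wpM2l.
  rewrite ler_wpM2l// ler_pdivrMr ?(lt_le_trans ltr01 ht)//.
  apply: (le_trans lt); rewrite -subr_ge0.
  have -> : (m%:R + 2) * t - (t * (m%:R + 1) + 1) = t - 1 by ring.
  by rewrite subr_ge0.
move: hnm; rewrite natrB// natrD => hnm.
set M : R := m%:R in e1 e2 e3 hnm *; set N : R := n%:R in hmu hnm *.
set I : R := i1%:R in hnm *.
have hM : (i1 + n)%:R <= M by rewrite ler_nat.
rewrite natrD -/I -/N in hM.
have e4 : (M - (I + N)) * H <= (K * M `^ (3 / 4) + 2) * lc.
  have q1 : (M - (I + N)) * H <= (M - (I + N)) * lc by rewrite ler_wpM2l// subr_ge0.
  by apply: (le_trans q1); rewrite ler_wpM2r// ltW.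
have e5 : I * H <= I * lc by rewrite ler_wpM2l// ler0n.
have e6 : Lam * (n + 25)%:R `^ (3 / 4) <= Lam * M `^ (3 / 4) by rewrite ler_wpM2l.
set E := M `^ (3 / 4) in e1 e4 e6 *.
have e4' : M * H - I * H - N * H <= K * lc * E + 2 * lc.
  have -> : M * H - I * H - N * H = (M - (I + N)) * H by ring.
  by apply: (le_trans e4); rewrite le_eqVlt; apply/orP; left; apply/eqP; ring.
rewrite mulrDl => hX1.
lra.
Qed.

End CostBound.

(** * One step of the construction *)

Definition approx_set {R : realType} (c : nat) (pi_ : 'I_c -> R) (t : R)
    (N : nat) : set R :=
  [set x | exists (p : int) (q : nat),
    [/\ (N <= q)%N, (0 < q)%N /\ coprime `|p|%N q,
        `|x - p%:~R / q%:R| <= q%:R `^ (- (2 * t))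
      & forall b : 'I_c,
          `|sigma c b (Num.truncn (2 * logb c (q%:R : R))) x - pi_ b|
            < N.+1%:R^-1]].

(** Half the product of the numbers [1 - pi_ b], which all lie in [[0, 1]]. The gap bounds both the
    length of constant runs of digits and the decay of the mass. *)
Lemma ex_uniform_gap (R : realType) (c : nat) (pi_ : 'I_c -> R) :
  (forall b, 0 < pi_ b < 1) -> exists2 kap : R, 0 < kap < 1 &
    forall b, kap <= 1 - pi_ b.
Proof.
move=> hpi; pose P : R := \prod_(b < c) (1 - pi_ b).
have h b : 0 <= 1 - pi_ b <= 1 by have /andP[? ?] := hpi b; apply/andP; split; lra.
have P0 : 0 < P by apply: prodr_gt0 => b _; have /andP[? ?] := hpi b; lra.
have PR b : P <= 1 - pi_ b.
  rewrite /P (bigD1 b)//= ler_piMr//; first by case/andP: (h b).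
  by apply: prodr_ile1 => i _; exact: h.
have P1 : P <= 1 by apply: prodr_ile1 => i _; exact: h.
exists (P / 2); first by apply/andP; split; lra.
by move=> b; have := PR b; lra.
Qed.

Section Step.
Context (R : realType) (t : R) (ht : 1 <= t) (c : nat) (hc : (2 <= c)%N).
Context (pi_ : 'I_c -> R) (hpi : forall b, 0 < pi_ b < 1).
Context (hpi1 : \sum_(b < c) pi_ b = 1) (eta : R) (heta : 0 < eta < 8^-1).
Context (g : R -> R) (e : R) (hge : gauge_on g e).
Hypothesis hg : gauge_prec g (h_ (entropy pi_ / t) (fun r => 3 * f_ eta r)).
(** [C i k] stands for the cost of the c-adic interval of level [i] and index [k]; [C_rat] says that
    every rational carries an atom. *)
Variable C : nat -> int -> R.
Hypothesis C_ge0 : forall i k, 0 <= C i k.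
Hypothesis C_sub : forall i (k : int), \sum_(b < c) C i.+1 (k * c + b) <= C i k.
Hypothesis C_mono : forall i j (x : R), (i <= j)%N ->
  C j (cfloor c j x) <= C i (cfloor c i x).
Hypothesis C_rat : forall (p : int) (q : nat), (0 < q)%N ->
  exists2 d : R, 0 < d & forall i, d <= C i (cfloor c i (p%:~R / q%:R : R)).

Let c0 : 0 < c%:R :> R. Proof. by rewrite ltr0n; lia. Qed.
Let cexp0 i : 0 < c%:R ^+ i :> R. Proof. exact: cexp_gt0. Qed.
Let cinv0 i : 0 < c%:R ^- i :> R. Proof. by rewrite invr_gt0. Qed.
Let lnc0 : 0 < ln c%:R :> R. Proof. by rewrite ln_gt0// ltr1n. Qed.

Let cinv_le i j : (i <= j)%N -> c%:R ^- j <= c%:R ^- i :> R.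
Proof. by move=> ij; rewrite lef_pV2 ?posrE// ler_weXn2l// ler1n; lia. Qed.

Variables (i0 : nat) (k0 : int).
Hypothesis i0e : c%:R ^- i0 <= e.
Hypothesis hJ : C i0 k0 < g (c%:R ^- i0).

Let cinv_e j : (i0 <= j)%N -> c%:R ^- j <= e.
Proof. by move=> /cinv_le h; exact: le_trans i0e. Qed.

Let G := g (c%:R ^- i0).
Let G0 : 0 < G. Proof. exact: le_lt_trans hJ. Qed.

Let g_mono i j : (i0 <= i)%N -> (i <= j)%N -> g (c%:R ^- j) <= g (c%:R ^- i).
Proof.
move=> hi ij; have [_ hm _ _] := hge.
by apply: hm; rewrite ?cinv_e ?cinv_le// ltW.
Qed.

Let g_ratio j : (i0 <= j)%N -> G * c%:R ^+ i0 / c%:R ^+ j <= g (c%:R ^- j).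
Proof.
move=> hj; have [_ _ _ hr] := hge.
have := hr _ _ (cinv0 j) (cinv_le hj) i0e.
by rewrite !invrK -/G => h; rewrite ler_pdivrMr.
Qed.

(** Some child always has at most the average cost. The bound obtained, proportional to length,
    stays below the gauge by [g_ratio]. *)
Lemma lebesgue_descent n : exists k,
  [/\ C (i0 + n) k < G * c%:R ^+ i0 / c%:R ^+ (i0 + n),
      forall x : R, cint c (i0 + n) k x -> cint c i0 k0 x
    & forall j (x : R), (i0 <= j <= i0 + n)%N -> cint c (i0 + n) k x ->
        C j (cfloor c j x) < G * c%:R ^+ i0 / c%:R ^+ j].
Proof.
elim: n => [|n [k [IH1 IH2 IH3]]].
  exists k0; rewrite addn0; split=> //; first by rewrite mulfK ?gt_eqF.
  move=> j x hj; have -> : j = i0 by move: hj; clear; lia.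
  by rewrite /cint/= => ->; rewrite mulfK ?gt_eqF.
have [b hb] : exists b : 'I_c, C (i0 + n).+1 (k * c + b) <
    G * c%:R ^+ i0 / c%:R ^+ (i0 + n).+1.
  apply: contrapT => /forallNP h.
  have := le_lt_trans (C_sub (i0 + n)%N k) IH1.
  apply/negP; rewrite -leNgt.
  have -> : G * c%:R ^+ i0 / c%:R ^+ (i0 + n) =
      \sum_(b < c) (G * c%:R ^+ i0 / c%:R ^+ (i0 + n).+1).
    rewrite sumr_const card_ord -[RHS]mulr_natr exprS.
    have := cexp0 (i0 + n); move: (_ ^+ (i0 + n)) => z z0.
    by field; rewrite !lt0r_neq0.
  by apply: ler_sum => b _; rewrite leNgt; apply/negP.
exists (k * c + b); rewrite addnS; split=> //.
  by move=> x /(cint_child hc) /IH2.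
move=> j x hj hx; have [ji|ji] := eqVneq j (i0 + n).+1.
  by rewrite ji [cfloor _ _ _]hx.
by apply: IH3 (cint_child hc hx); move: hj ji; clear; lia.
Qed.

Let abs_ln_sum := \sum_(b < c) `|ln (pi_ b)|.

(** The new interval is the one of level [l] around a good fraction [p / q]. Its ends lie strictly
    inside, so that limits are interior points; the cost is controlled at all intermediate levels
    because an element of the cover may have any of them. *)
Lemma approx_step (N : nat) : exists l k,
  [/\ (i0 < l)%N, k0%:~R / c%:R ^+ i0 < k%:~R / c%:R ^+ l :> R,
      (k%:~R + 1) / c%:R ^+ l < (k0%:~R + 1) / c%:R ^+ i0 :> R,
      cint c l k `<=` approx_set pi_ t N
    & forall j (x : R), (i0 <= j <= l)%N -> cint c l k x ->
        C j (cfloor c j x) < g (c%:R ^- j)].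
Proof.
have [kap /andP[kap0 kap1] hkap] := ex_uniform_gap hpi.
have H0 := nat_entropy_ge0 hpi.
have Hc : nat_entropy pi_ <= ln c%:R by apply: nat_entropy_le => //; exact: ltnW.
have L0 : 0 <= abs_ln_sum by apply: sumr_ge0.
have hg' := hg; rewrite (entropyE pi_) in hg'.
have [X hX] := cost_bound ht hc H0 Hc heta hg' i0 (2 / kap) G0 L0.
(* Beyond level [X] the cost bound holds; the extra 25 absorbs the shift in [n + 25]. *)
pose i1 := (i0 + (X + 25))%N.
have [u [hu1 hu2 hu3]] := lebesgue_descent (X + 25).
rewrite -/i1 in hu1 hu2 hu3.
set B := G * c%:R ^+ i0 / c%:R ^+ i1 in hu1.
have B0 : 0 < B by rewrite divr_gt0// mulr_gt0.
pose V (s : seq 'I_c) := C (i1 + size s) (cindex u s).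
have V0 s : 0 <= V s by exact: C_ge0.
have cost_small s m l : potential pi_ V B s < 1 -> (i1 + size s <= m)%N ->
    (m - (i1 + size s))%:R <= 2 / kap * m%:R `^ (3 / 4) + 2 -> (m <= l)%N ->
    l%:R <= t * (m%:R + 1) + 1 -> V s < g (c%:R ^- l).
  move=> hs h1 h2 h3 h4; apply: lt_trans (potential_cost hpi V0 B0 hs) _.
  apply: (hX i1 (size s) m l) => //; first by rewrite /i1; clear; lia.
    exact: (bernoulli_mass_gt0 hpi).
  apply: (ln_bernoulli_mass hpi) => b; exact: potential_freq hs.
have cost_small0 s : potential pi_ V B s < 1 -> V s < g (c%:R ^- (i1 + size s)).
  move=> hs; apply: (cost_small s (i1 + size s)%N) => //.
    rewrite subnn addr_ge0// mulr_ge0 ?powR_ge0// divr_ge0// ltW//.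
  have : 0 <= (i1 + size s)%:R :> R by [].
  move: (i1 + size s)%:R => M M0.
  have : M + 1 <= t * (M + 1) by rewrite ler_peMl// addr_ge0.
  lra.
have i1_ge : (i0 + 25 <= i1)%N by rewrite /i1; clear; lia.
have [d hd] : exists d, forall n, potential pi_ V B (prefix_of d n) < 1.
  apply: potential_path => //; first by rewrite /V addn0.
  by move=> s _; rewrite /V /= addnS; exact: C_sub.
clearbody i1.
pose K n := cindex u (prefix_of d n).
have VK n : V (prefix_of d n) = C (i1 + n) (K n) by rewrite /V size_prefix_of.
have freq n b : `|(count_mem b (prefix_of d n))%:R - n%:R * pi_ b| <=
    (n + 25)%:R `^ (3 / 4).
  by have := potential_freq hpi V0 B0 b (hd n); rewrite size_prefix_of.
(* A run of [s] digits [b] would raise the deviation of the count of [b] by at least [kap * s], more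
   than twice the allowed deviation. *)
have gap n s b : 2 * (n + s + 25)%:R `^ (3 / 4) < kap * s%:R ->
    exists2 m, (n <= m < n + s)%N & d m != b.
  move=> hs; apply: contrapT => /forall2NP h.
  have h1 : count_mem b (prefix_of d (n + s)) = (count_mem b (prefix_of d n) + s)%N.
    apply: (count_prefix_const hc) => m hm.
    by have [//|/negP] := h m; rewrite negbK => /eqP.
  have := freq (n + s)%N b; have := freq n b.
  have h2 : (n + 25)%:R `^ (3 / 4) <= (n + s + 25)%:R `^ (3 / 4) :> R.
    by apply: ge0_ler_powR; rewrite ?nnegrE ?ler0n ?ler_nat ?leq_add2r ?leq_addr//; lra.
  have h3 : kap * s%:R <= (1 - pi_ b) * s%:R by rewrite ler_wpM2r.
  move: hs h2; move: (_ `^ _) (_ `^ _) => z1 z2 hs h2.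
  rewrite h1 !natrD !ler_norml => /andP[h4 _] /andP[_ h5].
  lra.
have [y hy] : exists y : R, forall n, cint c (i1 + n) (K n) y.
  apply: cint_path => // n.
  have c1 : (c.-1 < c)%N by rewrite prednK// ltnW.
  (* The constant 26, one more than the shift 25, gives the strict inequality required by [gap]. *)
  have [Y hY] := @powR_affine_growth R (3 / 4) 1 2 (kap * (n + 26)%:R) kap
    ltac:(lra) ltac:(lra) kap0.
  have [|m hm hm2] := gap n Y (Ordinal c1); last by exists m => //; case/andP: hm.
  have := hY (n + Y + 25)%N; rewrite powRr1// => /(_ ltac:(clear; lia)).
  have -> : kap * (n + Y + 25)%:R = kap * Y%:R + kap * (n + 26)%:R - kap.
    by rewrite !natrD; ring.
  lra.
(* At a rational the cost would stay above its atom, whereas along [y] it is at most a multiple of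
   the mass, which tends to 0. *)
have irr : irrational_num y.
  move=> p q q0; apply/eqP => yE.
  have [dl dl0 hdl] := C_rat p q0; rewrite -yE in hdl.
  have mu_le n : bernoulli_mass pi_ (prefix_of d n) <= (1 - kap) ^+ n.
    elim: n => [|n IH]; first by rewrite /bernoulli_mass big_nil.
    rewrite /= bernoulli_mass_cons exprS ler_pM//.
    - by case/andP: (hpi (d n)) => /ltW.
    - exact/ltW/(bernoulli_mass_gt0 hpi).
    - by have := hkap (d n); lra.
  have /cvgrPdist_lt /(_ (dl / (2 * B))) : (fun n => (1 - kap) ^+ n) @ \oo --> (0 : R).
    by apply: cvg_expr; rewrite ger0_norm; lra.
  rewrite divr_gt0 ?mulr_gt0// => /(_ isT)[n0 _ /(_ n0 (leqnn _))].
  rewrite sub0r normrN ger0_norm ?exprn_ge0; try lra.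
  rewrite ltr_pdivlMr ?mulr_gt0// => h.
  have h1 := potential_cost hpi V0 B0 (hd n0).
  have h2 := hdl (i1 + n0)%N; rewrite (hy n0) -VK in h2.
  have := le_lt_trans h2 h1; apply/negP; rewrite -leNgt.
  apply: le_trans (ltW h); rewrite [leRHS]mulrC ler_pM2l ?mulr_gt0//.
have eps0 : 0 < (2 * N.+1%:R)^-1 :> R by rewrite invr_gt0 mulr_gt0.
(* For large [m] the uncontrolled digits and the deviation together take at most half of the
   tolerance [m / (N + 1)]. *)
have [X3 hX3] := @powR_affine_growth R (3 / 4) 1 (1 + 2 / kap) (i1%:R + 4) _
  ltac:(lra) ltac:(lra) eps0.
(* The term [N] gives the lower bound on [q] demanded by [approx_set], and [c ^ X3] makes
   [2 log_c q] at least [X3]. *)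
have [p [q [qN cop hpq]]] := dirichlet_coprime (N + c ^ X3) irr.
have q0 : (0 < q)%N by apply: leq_ltn_trans qN.
have qR : 0 < q%:R :> R by rewrite ltr0n.
have lc0 := lnc0; set lc := ln c%:R in lc0 Hc.
pose M : R := 2 * logb c q%:R; pose m := Num.truncn M.
have Mlc : M * lc = 2 * ln q%:R by rewrite /M /logb -/lc mulrA mulfVK ?gt_eqF.
have XM : X3%:R <= M.
  have h : X3%:R * lc <= ln q%:R.
    rewrite mulr_natl -lnXn// ler_ln ?posrE// -natrX ler_nat.
    by apply: leq_trans (ltnW qN); exact: leq_addl.
  have h0 : 0 <= X3%:R * lc by rewrite mulr_ge0// ltW.
  by rewrite -(ler_pM2r lc0) Mlc; lra.
have M0 : 0 <= M by apply: le_trans XM.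
have /andP[mM Mm] := truncn_itv M0; rewrite -/m in mM Mm.
have mX : (X3 <= m)%N by rewrite truncn_ge_nat.
set f := m%:R `^ (3 / 4) : R.
have f0 : 0 <= f by exact: powR_ge0.
have hm := hX3 m mX; rewrite powRr1// -/f in hm.
have kf0 : 0 <= 2 / kap * f by rewrite mulr_ge0// divr_ge0// ltW.
(* The least integer with [kap * s > 2 * f]: no run of equal digits of this length occurs. *)
pose s := (Num.truncn (2 / kap * f)).+1.
have /andP[s_hi s_lo] := truncn_itv kf0; rewrite -/s in s_lo.
have {}s_hi : s%:R <= 2 / kap * f + 1 by rewrite /s -natr1 lerD2r.
have s_hi2 : (s + 1)%:R <= 2 / kap * f + 2 by rewrite natrD; lra.
have s0 : (0 < s)%N by [].
clearbody s.
have i1R : 0 <= i1%:R :> R by [].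
have hm' : s%:R + i1%:R + f + 3 <= (2 * N.+1%:R)^-1 * m%:R.
  by apply: le_trans hm; rewrite mulrDl mul1r; lra.
have m0 : 0 < m%:R :> R.
  by rewrite -(pmulr_rgt0 _ eps0); apply: lt_le_trans hm'; have : 0 <= s%:R :> R by []; lra.
have em1 : (2 * N.+1%:R)^-1 * m%:R <= m%:R :> R.
  rewrite ler_piMl ?(ltW m0)// invf_le1 ?mulr_gt0//.
  by have : 1 <= N.+1%:R :> R; [rewrite ler1n|lra].
have hs : (s + i1 + 1 <= m)%N.
  by rewrite -(ler_nat R) natrD natrD; apply: le_trans (le_trans hm' em1); lra.
(* The level left free between [i1 + n + s] and [m] gains a factor [c >= 2], used to add two
   distances of size [q ^- 2]. *)
pose n := (m - 1 - s - i1)%N.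
have en : (i1 + n + s).+1 = m by move: hs; rewrite /n; clear; lia.
clearbody n.
have gapn : 2 * (n + s + 25)%:R `^ (3 / 4) < kap * s%:R.
  have h : (n + s + 25)%:R `^ (3 / 4) <= f.
    have nsm : (n + s + 25 <= m)%N by move: en i1_ge; clear; lia.
    by apply: ge0_ler_powR; rewrite ?nnegrE ?ler0n ?ler_nat ?nsm//; lra.
  have : kap * (2 / kap * f) < kap * s%:R by rewrite ltr_pM2l.
  have -> : kap * (2 / kap * f) = 2 * f by field; rewrite gt_eqF.
  by lra.
have fin : i1%:R + (n + 25)%:R `^ (3 / 4) + (s + 1)%:R < N.+1%:R^-1 * m%:R :> R.
  have h : (n + 25)%:R `^ (3 / 4) <= f.
    have nsm : (n + 25 <= m)%N by move: en i1_ge; clear; lia.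
    by apply: ge0_ler_powR; rewrite ?nnegrE ?ler0n ?ler_nat ?nsm//; lra.
  have h2 : (2 * N.+1%:R)^-1 * m%:R < N.+1%:R^-1 * m%:R :> R.
    by rewrite ltr_pM2r// ltf_pV2 ?posrE ?mulr_gt0// ltr_pMl// ltr1n.
  have s1 : (s + 1)%:R = s%:R + 1 :> R by rewrite natrD.
  by rewrite s1; apply: le_lt_trans h2; apply: le_trans hm'; lra.
have digit_far b : exists2 p, (i1 + n < p <= i1 + n + s)%N & cdigit c p y != b :> nat.
  have [bc|bc] := ltnP b c; last first.
    exists (i1 + n).+1; first by rewrite ltnSn -addn1 leq_add2l s0.
    by rewrite neq_ltn (leq_trans (cdigit_lt hc _ _) bc).
  have [j hj hdj] := gap n s (Ordinal bc) gapn.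
  exists (i1 + j).+1; first by move: hj; clear; lia.
  by rewrite (cdigit_path hc (ltnSn j) (hy j.+1)).
have ball x : `|x - y| < c%:R ^- (i1 + n + s) ->
    (K n)%:~R / c%:R ^+ (i1 + n) < x < ((K n)%:~R + 1) / c%:R ^+ (i1 + n).
  exact: (cint_ball hc (hy n) (digit_far _) (digit_far _)).
have q2 : c%:R ^+ m <= q%:R ^+ 2 :> R.
  rewrite -ler_ln ?posrE ?exprn_gt0// !lnXn// -/lc.
  by rewrite -[leLHS]mulr_natl -[leRHS]mulr_natl -Mlc ler_pM2r.
have r2 : 2 * q%:R ^- 2 <= c%:R ^- (i1 + n + s) :> R.
  apply: le_trans (_ : 2 * c%:R ^- m <= _).
    by rewrite ler_pM2l// lef_pV2 ?posrE ?exprn_gt0.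
  rewrite -en exprS invfM mulrA; apply: ler_piMl; first exact: ltW.
  by rewrite ler_pdivrMr// mul1r ler_nat.
have qt : q%:R `^ (- (2 * t)) <= q%:R ^- 2 :> R.
  rewrite powRN lef_pV2 ?posrE ?powR_gt0 ?exprn_gt0//.
  by rewrite -powR_mulrn ?(ltW qR)// ler_powR ?ler1n// ler_peMr.
have tM0 : 0 <= t * M by rewrite mulr_ge0// (le_trans ler01 ht).
(* Since [q ^ (- 2 t) = c ^ (- t M)], this is the first level whose intervals are shorter than
   [q ^ (- 2 t)]. *)
pose l := (Num.truncn (t * M)).+1.
have /andP[l_hi l_lo] := truncn_itv tM0; rewrite -/l in l_lo.
have {}l_hi : l%:R <= t * M + 1 by rewrite /l -natr1 lerD2r.
clearbody l.
have cl : c%:R ^- l < q%:R `^ (- (2 * t)) :> R.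
  rewrite -ltr_ln ?posrE ?powR_gt0// (ln_cinv _ _ hc) ln_powR mulNr ltrN2 -/lc.
  have -> : 2 * t * ln q%:R = t * M * lc by rewrite -[RHS]mulrA Mlc; ring.
  by rewrite ltr_pM2r.
have ml : (m <= l)%N.
  rewrite -(ler_nat R) (le_trans mM)// (le_trans _ (ltW l_lo))//.
  by rewrite ler_peMl.
pose x0 : R := p%:~R / q%:R; pose k := cfloor c l x0.
have hk : cint c l k x0 by [].
clearbody k.
have dist_x0 (z : R) : k%:~R / c%:R ^+ l <= z <= (k%:~R + 1) / c%:R ^+ l ->
    `|z - x0| <= c%:R ^- l by exact: cint_dist.
(* Both [|z - p / q|] and [|y - p / q|] are below [q ^- 2], so the closed interval around [p / q]
   stays inside the interval of [y] of level [i1 + n]. *)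
have inball (z : R) : k%:~R / c%:R ^+ l <= z <= (k%:~R + 1) / c%:R ^+ l ->
    (K n)%:~R / c%:R ^+ (i1 + n) < z < ((K n)%:~R + 1) / c%:R ^+ (i1 + n).
  move=> hz; have h := dist_x0 _ hz; apply: ball; apply: lt_le_trans r2.
  have -> : z - y = (z - x0) - (y - x0) by ring.
  apply: le_lt_trans (ler_normB _ _) _.
  rewrite mulr_natl mulr2n ltrD//; apply: le_lt_trans h _.
  exact: lt_le_trans cl qt.
have left_le : k%:~R / c%:R ^+ l <= (k%:~R + 1) / c%:R ^+ l :> R.
  by rewrite ler_pM2r// lerDl.
have cint_n (z : R) : k%:~R / c%:R ^+ l <= z <= (k%:~R + 1) / c%:R ^+ l ->
    cint c (i1 + n) (K n) z.
  by move=> hz; have /andP[/ltW h1 h2] := inball _ hz; apply/(cintP' hc); rewrite h1.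
have cint_l (z : R) : cint c l k z -> k%:~R / c%:R ^+ l <= z <= (k%:~R + 1) / c%:R ^+ l.
  by move=> /(cintP' hc) /andP[-> /ltW].
have cint_u (z : R) : cint c (i1 + n) (K n) z -> cint c i1 u z.
  by move=> /(cint_path_prefix hc (leq0n n)); rewrite addn0.
have cint_J (z : R) : cint c (i1 + n) (K n) z ->
    k0%:~R / c%:R ^+ i0 <= z < (k0%:~R + 1) / c%:R ^+ i0.
  by move=> /cint_u /hu2 /(cintP' hc).
have Vn : (i1 + n <= m)%N -> V (prefix_of d n) < g (c%:R ^- l).
  move=> _; apply: (cost_small _ m l) => //; rewrite ?size_prefix_of//.
  - by move: en; clear; lia.
  - have -> : (m - (i1 + n) = s + 1)%N by move: en; clear; lia.
    exact: s_hi2.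
  - apply: (le_trans l_hi); rewrite lerD2r ler_pM2l ?(lt_le_trans ltr01 ht)//.
    by rewrite natr1 ltW.
exists l, k; split.
- by apply: leq_trans ml; move: en i1_ge; clear; lia.
- have /andP[h _] := inball _ (introT andP (conj (lexx _) left_le)).
  apply: le_lt_trans h.
  have : cint c (i1 + n) (K n) ((K n)%:~R / c%:R ^+ (i1 + n) : R).
    by apply/(cintP' hc); rewrite lexx/= ltr_pM2r// ltrDl.
  by move=> /cint_J /andP[].
- have := cint_n _ (introT andP (conj left_le (lexx _))).
  by move=> /cint_J /andP[].
- move=> x hx; exists p, q; split => //.
  + by apply: leq_trans (ltnW qN); exact: leq_addr.
  + by apply: ltW; apply: le_lt_trans (dist_x0 _ (cint_l _ hx)) cl.
  + move=> b; rewrite /sigma -/M -/m.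
    (* Every point of the new interval shares the digits of [y] up to position [i1 + n]. *)
    have hxn := cint_n _ (cint_l _ hx).
    have nm : (i1 + n <= m)%N by move: en; clear; lia.
    have pb : 0 <= pi_ b <= 1 by case/andP: (hpi b) => /ltW -> /ltW ->.
    have := digit_freq_bound hc hxn nm pb (freq n b).
    set cnt := count _ _ => hcnt.
    have -> : cnt%:R / m%:R - pi_ b = (cnt%:R - m%:R * pi_ b) / m%:R.
      by field; rewrite gt_eqF.
    rewrite normrM [`|_^-1|]ger0_norm ?invr_ge0 ?(ltW m0)// ltr_pdivrMr//.
    apply: le_lt_trans hcnt _.
    have -> : (m - (i1 + n) = s + 1)%N by move: en; clear; lia.
    exact: fin.
- move=> j x /andP[ij jl] hx.
  have hxn := cint_n _ (cint_l _ hx).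
  (* Up to [i1] the descent bounds the cost, up to [i1 + n] the potential does; beyond, the cost at
     level [i1 + n] is already below the gauge at level [l]. *)
  have [ji|ij1] := leqP j i1.
    apply: lt_le_trans (g_ratio ij).
    by apply: hu3; [rewrite ij|exact: cint_u].
  have [jn|nj] := leqP j (i1 + n).
    have ej : j = (i1 + (j - i1))%N by rewrite subnKC// ltnW.
    have jn' : (j - i1 <= n)%N by rewrite leq_subLR.
    have := cint_path_prefix hc jn' hxn; rewrite /cint/= -{1}ej => ->.
    by have := cost_small0 _ (hd (j - i1)%N); rewrite VK size_prefix_of -ej.
  apply: le_lt_trans (C_mono x (ltnW nj)) _; rewrite [cfloor _ _ _]hxn -VK.
  by apply: lt_le_trans (Vn _) (g_mono ij jl); move: en; clear; lia.
Qed.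

End Step.

(** * Costs of c-adic covers *)

Section Diameter.
Context (R : realType).

Lemma diam_set0 : diam (set0 : set R) = 0.
Proof.
rewrite /diam (_ : [set _ | _ in _ & _ in _] = set0) ?sup0//.
by apply/seteqP; split=> // z [x []].
Qed.

Lemma diam_itv (a b : R) : a < b -> diam [set x | a <= x < b] = b - a.
Proof.
move=> ab; rewrite /diam; set S := [set _ | _ in _ & _ in _].
have ub z : S z -> z <= b - a.
  move=> [x /= /andP[x1 x2]] [y /= /andP[y1 y2]] <-.
  by rewrite ler_norml; apply/andP; split; lra.
have S0 : S 0.
  have aa : [set x | a <= x < b] a by rewrite /= lexx.
  by exists a => //; exists a => //; rewrite subrr normr0.
have hS : has_sup S by split; [exists 0|exists (b - a) => z /ub].
apply/eqP; rewrite eq_le ge_sup//=; last by exists 0.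
rewrite leNgt; apply/negP => h.
have s0 : 0 <= sup S by apply: ub_le_sup => //; exact: hS.2.
(* The value [b - a] is not attained; a smaller supremum would be exceeded by the midpoint between
   the two. *)
have : S ((sup S + (b - a)) / 2).
  exists (a + (sup S + (b - a)) / 2); first by apply/andP; split; lra.
  by exists a; [rewrite /= lexx|rewrite addrAC subrr add0r ger0_norm; lra].
by move=> /(ub_le_sup hS.2); lra.
Qed.

Lemma gauge_on_le (g : R -> R) (e e' : R) : e' <= e -> gauge_on g e ->
  gauge_on g e'.
Proof.
move=> ee [h1 h2 h3 h4]; split.
- by apply: continuous_subspaceW h1; apply: subset_itvl; rewrite bnd_simp.
- by move=> r s r0 rs se; apply: h2 => //; exact: le_trans ee.
- by move=> r r0 re; apply: h3 => //; exact: le_trans ee.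
- by move=> r s r0 rs se; apply: h4 => //; exact: le_trans ee.
Qed.

Lemma gauge_eps_le1 (g : R -> R) : gauge_eps g <= 1.
Proof.
rewrite /gauge_eps; set S := [set _ | _].
have [->|/set0P S0] := eqVneq S set0; first by rewrite sup0.
by apply: ge_sup => // x [].
Qed.

Lemma lt_gauge_eps (g : R -> R) r : 0 <= r -> r < gauge_eps g ->
  exists2 e, r < e & gauge_on g e.
Proof.
rewrite /gauge_eps; set S := [set _ | _] => r0 h.
have [S0|/set0P S0] := eqVneq S set0.
  by move: h; rewrite S0 sup0 ltNge r0.
have hS : has_sup S by split => //; exists 1 => x [].
have d0 : 0 < sup S - r by rewrite subr_gt0.
have [x [_ _ hx] xr] := sup_adherent d0 hS.
by exists x => //; move: xr; rewrite subKr.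
Qed.

Lemma gauge_gt0 (g : R -> R) e r : gauge_on g e -> 0 < r <= e -> 0 < g r.
Proof.
move=> [_ _ h _] /andP[r0 re]; have := h _ r0 re.
by rewrite pmulr_lgt0 ?invr_gt0.
Qed.

End Diameter.

Section CadicSets.
Context (R : realType) (c : nat) (hc : (2 <= c)%N).
Implicit Types (i j : nat) (k : int) (x : R).

Let c0 : 0 < c%:R :> R. Proof. by rewrite ltr0n ltnW. Qed.

Lemma cintE i k : cint c i k =
  [set x : R | k%:~R / c%:R ^+ i <= x < (k%:~R + 1) / c%:R ^+ i].
Proof. by apply/seteqP; split=> x /(cintP' hc). Qed.

Lemma cint_left i k : cint c i k (k%:~R / c%:R ^+ i : R).
Proof.
by rewrite cintE/= lexx/= ltr_pM2r ?invr_gt0 ?exprn_gt0// ltrDl.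
Qed.

Lemma diam_cint i k : diam (cint c i k : set R) = c%:R ^- i.
Proof.
rewrite cintE diam_itv; first by rewrite mulrDl mul1r addrAC subrr add0r.
by rewrite ltr_pM2r ?invr_gt0 ?exprn_gt0// ltrDl.
Qed.

Lemma cadic_cint i k : cadic c (cint c i k : set R).
Proof.
exists i, k; rewrite cintE; apply/seteqP; split=> x /=;
  rewrite in_itv/= -exprnN -[c%:R ^- i]/((c%:R ^+ i)^-1) ![(c%:R ^+ i)^-1 * _]mulrC//.
Qed.

(** Intervals of negative level have length at least 1. With [gauge_eps_le1], the elements of a
    cover therefore have levels in [nat]. *)
Lemma cadic_lt1 (A : set R) : cadic c A -> diam A < 1 ->
  exists i k, A = cint c i k.
Proof.
move=> [j [k ->]].
have pj : 0 < c%:R ^ (- j) :> R by rewrite exprz_gt0.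
have -> : `[c%:R ^ (- j) * k%:~R, c%:R ^ (- j) * (k%:~R + 1)[%classic =
    [set x : R | c%:R ^ (- j) * k%:~R <= x < c%:R ^ (- j) * (k%:~R + 1)].
  by apply/seteqP; split => x /=; rewrite in_itv.
rewrite diam_itv; last by rewrite ltr_pM2l// ltrDl.
rewrite mulrDr mulr1 addrAC subrr add0r.
case: j pj => [i|i] pj; last first.
  by rewrite NegzE opprK -exprnP ltNge exprn_ege1// ler1n ltnW//.
move=> _; exists i, k; rewrite cintE; apply/seteqP; split=> x /=;
  by rewrite -exprnN mulrDl mul1r ![c%:R ^- i * _]mulrC.
Qed.

Lemma cint_nested i j k k' x : (i <= j)%N -> cint c i k x -> cint c j k' x ->
  cint c j k' `<=` (cint c i k : set R).
Proof.
move=> ij; rewrite /cint => /= <- <- z /= h.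
exact: (cfloor_le hc ij).
Qed.

Definition indicator_sub (P A : set R) : R := (`[< P `<=` A >])%:R.

Lemma indicator_sub_ge0 P A : 0 <= indicator_sub P A. Proof. exact: ler0n. Qed.

Lemma indicator_sub_le P A B : A `<=` B -> indicator_sub P A <= indicator_sub P B.
Proof.
move=> AB; rewrite /indicator_sub; case: (asboolP (P `<=` A)) => // PA.
by rewrite (asboolT (subset_trans PA AB)).
Qed.

(** The children are disjoint, so a nonempty set lies in at most one of them; the empty set would
    lie in all. *)
Lemma indicator_sub_children P i k : P !=set0 ->
  \sum_(b < c) indicator_sub P (cint c i.+1 (k * c + b)) <=
    indicator_sub P (cint c i k).
Proof.
move=> [x Px].
have [/existsP[b /asboolP hb]|] :=
    boolP [exists b : 'I_c, `[< P `<=` cint c i.+1 (k * c + b) >]]; last first.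
  rewrite negb_exists => /forallP h; rewrite big1 ?indicator_sub_ge0// => b _.
  by rewrite /indicator_sub (negPf (h b)).
rewrite (bigD1 b)//= big1 ?addr0 => [|b' b'b].
  by apply: indicator_sub_le => z; exact: cint_child.
rewrite /indicator_sub; case: asboolP => // h.
have := h _ Px; have := hb _ Px; rewrite /cint/= => -> /addrI [] bb'.
by move: b'b; rewrite (val_inj bb') eqxx.
Qed.

End CadicSets.

Section CostFunction.
Context (R : realType) (c : nat) (hc : (2 <= c)%N).

Definition rat_enum (n : nat) : R := ratr (odflt 0 (unpickle n)).

Lemma rat_enum_frac (p : int) (q : nat) : exists n,
  rat_enum n = p%:~R / q%:R.
Proof.
exists (pickle (p%:~R / q%:R : rat)).
by rewrite /rat_enum pickleK [odflt _ _]/(_ / _) fmorph_div rmorph_int rmorph_nat.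
Qed.

(* The total weight of the sets [l p] inside a c-adic interval, plus an atomic
   measure of mass at most [eps] charging every rational, which forces the points
   of small cost to be irrational. *)
Lemma cost_function (w : nat -> R) (l : nat -> set R) (eps : R) :
  (forall p, 0 <= w p) -> (forall p, l p = set0 -> w p = 0) -> 0 < eps ->
  (\sum_(0 <= p <oo) (w p)%:E < +oo)%E ->
  exists C : nat -> int -> R,
  [/\ forall i k, 0 <= C i k,
      forall i (k : int), \sum_(b < c) C i.+1 (k * c + b) <= C i k,
      forall i j (x : R), (i <= j)%N -> C j (cfloor c j x) <= C i (cfloor c i x),
      forall (p : int) (q : nat), (0 < q)%N -> exists2 d : R, 0 < d &
        forall i, d <= C i (cfloor c i (p%:~R / q%:R : R))
    & (forall i k p, l p `<=` cint c i k -> w p <= C i k) /\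
      (forall i k, (C i k)%:E <= \sum_(0 <= p <oo) (w p)%:E + eps%:E)%E].
Proof.
move=> w0 wl eps0 wfin.
(* Atoms of total mass [eps]. *)
pose a p := eps / 2 ^+ p.+1.
have a0 p : 0 < a p by rewrite divr_gt0.
pose T i (k : int) p := w p * indicator_sub (l p) (cint c i k) +
  a p * indicator_sub [set rat_enum p] (cint c i k).
have T0 i k p : 0 <= T i k p.
  by rewrite addr_ge0// mulr_ge0 ?indicator_sub_ge0// ltW.
have TE0 i k p : (0 <= (T i k p)%:E)%E by rewrite lee_fin.
pose Ce i k := (\sum_(0 <= p <oo) (T i k p)%:E)%E.
have ind1 (P A : set R) : indicator_sub P A <= 1 by rewrite /indicator_sub lern1; case: asboolP.
have CeW i k : (Ce i k <= \sum_(0 <= p <oo) (w p)%:E + eps%:E)%E.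
  apply: le_trans (_ : \sum_(0 <= p <oo) ((w p)%:E + (eps / (2 ^ p.+1)%:R)%:E) <= _)%E.
    apply: lee_nneseries => [p _ _|p _]; first exact: TE0.
    rewrite -EFinD lee_fin /T natrX lerD// ler_piMr// ltW//; exact: a0.
  by apply: epsilon_trick => [p|]; rewrite ?lee_fin// ltW.
have Cfin i k : Ce i k \is a fin_num.
  rewrite ge0_fin_numE; last exact: nneseries_ge0.
  by apply: le_lt_trans (CeW i k) _; rewrite lte_add_pinfty// ltry.
pose C i k := fine (Ce i k).
have CE i k : (C i k)%:E = Ce i k by rewrite fineK.
have T_le_C i k p : T i k p <= C i k.
  rewrite -lee_fin CE; apply: le_trans (nneseries_lim_ge p.+1 _) => //.
  by rewrite big_nat_recr//= leeDr// sume_ge0.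
exists C; split.
- by move=> i k; rewrite -lee_fin CE; exact: nneseries_ge0.
- move=> i k; rewrite -lee_fin -sumEFin CE.
  under eq_bigr do rewrite CE.
  rewrite -nneseries_sum//; apply: lee_nneseries => [p _ _|p _].
    exact: sume_ge0.
  rewrite sumEFin lee_fin big_split/= -!mulr_sumr lerD//.
    have [/wl ->|/set0P l0] := eqVneq (l p) set0; first by rewrite !mul0r.
    by rewrite ler_wpM2l// indicator_sub_children.
  rewrite ler_wpM2l ?(ltW (a0 p))// indicator_sub_children//.
  by exists (rat_enum p).
- move=> i j x ij; rewrite -lee_fin !CE; apply: lee_nneseries => [p _ _|p _] //.
  have h : cint c j (cfloor c j x) `<=` (cint c i (cfloor c i x) : set R).
    exact: (@cint_nested _ _ hc _ _ _ _ x).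
  by rewrite lee_fin lerD// ler_wpM2l ?(ltW (a0 p))// indicator_sub_le.
- move=> p q _; have [n hn] := rat_enum_frac p q.
  exists (a n) => // i; apply: le_trans (T_le_C i _ n).
  rewrite /T [X in a n * X](_ : _ = 1) ?mulr1 ?lerDr ?mulr_ge0 ?indicator_sub_ge0//.
  by rewrite /indicator_sub asboolT// hn => _ ->.
- split => [i k p h|i k]; last by rewrite CE.
  apply: le_trans (T_le_C i k p).
  by rewrite /T {1}/indicator_sub asboolT// mulr1 lerDl mulr_ge0 ?indicator_sub_ge0// ltW.
Qed.

End CostFunction.

(** * Nested intervals and the cost of a local cover *)

Section NestedCadic.
Context (R : realType) (c : nat) (hc : (2 <= c)%N).

(** The supremum of the left ends; strict nesting on both sides keeps it off every end. *)
Lemma nested_cadic_point (i : nat -> nat) (k : nat -> int) :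
  (forall n, (k n)%:~R / c%:R ^+ i n < (k n.+1)%:~R / c%:R ^+ i n.+1 :> R) ->
  (forall n, ((k n.+1)%:~R + 1) / c%:R ^+ i n.+1 <
     ((k n)%:~R + 1) / c%:R ^+ i n :> R) ->
  exists x : R, forall n,
    (k n)%:~R / c%:R ^+ i n < x < ((k n)%:~R + 1) / c%:R ^+ i n.
Proof.
set L := fun n => (k n)%:~R / c%:R ^+ i n : R.
set T := fun n => ((k n)%:~R + 1) / c%:R ^+ i n : R.
move=> hL hT.
have LT n : L n <= T n.
  by rewrite /T mulrDl lerDl divr_ge0// exprn_ge0.
have Lm n m : L n <= L (n + m)%N.
  elim: m => [|m IH]; first by rewrite addn0.
  by rewrite addnS (le_trans IH)//; exact/ltW/hL.
have Tm n m : T (n + m)%N <= T n.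
  elim: m => [|m IH]; first by rewrite addn0.
  by rewrite addnS (le_trans _ IH)//; exact/ltW/hT.
have LTnm n m : L n <= T m.
  have [nm|nm] := leqP n m.
    by rewrite (le_trans _ (LT m))// -(subnKC nm).
  by rewrite (le_trans (LT n))// -(subnKC (ltnW nm)).
have hs : has_sup (range L).
  by split; [exists (L 0%N); exists 0%N|exists (T 0%N) => _ [n _ <-]].
exists (sup (range L)) => n; apply/andP; split.
  by apply: lt_le_trans (hL n) _; apply: ub_le_sup; [exact: hs.2|exists n.+1].
apply: le_lt_trans (hT n); apply: ge_sup; first exact: hs.1.
by move=> _ [m _ <-]; exact: LTnm.
Qed.

Lemma interior_cint (i : nat) (k : int) (A : set R) (x : R) :
  cint c i k `<=` A -> k%:~R / c%:R ^+ i < x < (k%:~R + 1) / c%:R ^+ i ->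
  interior A x.
Proof.
move=> hA hx.
have : \forall z \near x, z \in `]k%:~R / c%:R ^+ i, (k%:~R + 1) / c%:R ^+ i[.
  by apply: near_in_itvoo; rewrite in_itv.
apply: filterS => z /=; rewrite in_itv/= => /andP[/ltW z1 z2].
by apply: hA; apply/(cintP' hc); rewrite z1.
Qed.

End NestedCadic.

Definition approx_Gdelta {R : realType} (c : nat) (pi_ : 'I_c -> R) (t : R) :
    set R := \bigcap_N interior (approx_set pi_ t N).

Section LocalCost.
Context (R : realType) (t : R) (ht : 1 <= t) (c : nat) (hc : (2 <= c)%N).
Context (pi_ : 'I_c -> R) (hpi : forall b, 0 < pi_ b < 1).
Context (hpi1 : \sum_(b < c) pi_ b = 1) (eta : R) (heta : 0 < eta < 8^-1).
Context (g : R -> R) (e : R) (hge : gauge_on g e) (g0 : g 0 = 0).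
Hypothesis hg : gauge_prec g (h_ (entropy pi_ / t) (fun r => 3 * f_ eta r)).

(** If the cost were smaller, iterating [approx_step] with [N = 0, 1, 2, ...] would give a point of
    the set in the interval. The element of the cover containing this point has a level above [i0],
    lying between two successive stages, where the cost is below the gauge; but the cost counts that
    element. *)
Lemma local_cost (i0 : nat) (k0 : int) (l : nat -> set R) :
  c%:R ^- i0 <= e ->
  (forall p, (exists i k, l p = cint c i k) \/ l p = set0) ->
  (forall p, 0 <= g (diam (l p))) ->
  approx_Gdelta pi_ t `&` cint c i0 k0 `<=` \bigcup_p l p ->
  ~ (exists p, cint c i0 k0 `<=` l p) ->
  ((g (c%:R ^- i0))%:E <= \sum_(0 <= p <oo)
     (if `[< l p `<=` cint c i0 k0 >] then g (diam (l p)) else 0)%:E)%E.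
Proof.
move=> i0e hl hgl hcov hnot; rewrite leNgt; apply/negP => hlt.
set w := fun p => if `[< l p `<=` cint c i0 k0 >] then g (diam (l p)) else 0.
rewrite -/w in hlt.
have w0 p : 0 <= w p by rewrite /w; case: ifP.
have wl p : l p = set0 -> w p = 0.
  by rewrite /w => ->; rewrite diam_set0 g0 if_same.
have wS_ge0 : (0 <= \sum_(0 <= p <oo) (w p)%:E)%E.
  by apply: nneseries_ge0 => p _ _; rewrite lee_fin.
have wfin : (\sum_(0 <= p <oo) (w p)%:E < +oo)%E by rewrite (lt_trans hlt)// ltry.
have [S hS] : exists S, (\sum_(0 <= p <oo) (w p)%:E = S%:E)%E.
  by exists (fine (\sum_(0 <= p <oo) (w p)%:E)%E); rewrite fineK// ge0_fin_numE.
rewrite hS lte_fin in hlt.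
(* Half of the slack, so that the atoms keep the cost below the gauge. *)
pose eps := (g (c%:R ^- i0) - S) / 2.
have eps0 : 0 < eps by rewrite divr_gt0// subr_gt0.
have [C [C0 Csub Cmono Crat [Cw CS]]] := cost_function hc w0 wl eps0 wfin.
have CJ : C i0 k0 < g (c%:R ^- i0).
  have := CS i0 k0; rewrite hS -EFinD lee_fin => /le_lt_trans; apply.
  by rewrite /eps; lra.
pose inv (s : nat * int) := (i0 <= s.1)%N /\ C s.1 s.2 < g (c%:R ^- s.1).
pose rel N (s s' : nat * int) := [/\ (s.1 < s'.1)%N,
  s.2%:~R / c%:R ^+ s.1 < s'.2%:~R / c%:R ^+ s'.1 :> R,
  (s'.2%:~R + 1) / c%:R ^+ s'.1 < (s.2%:~R + 1) / c%:R ^+ s.1 :> R,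
  cint c s'.1 s'.2 `<=` approx_set pi_ t N
  & forall j (x : R), (s.1 <= j <= s'.1)%N -> cint c s'.1 s'.2 x ->
        C j (cfloor c j x) < g (c%:R ^- j)].
have hstep N s : exists s', inv s -> rel N s s'.
  have [[h1 h2]|h] := pselect (inv s); last by exists s => /h.
  have he : c%:R ^- s.1 <= e.
    apply: le_trans i0e; rewrite lef_pV2 ?posrE ?cexp_gt0//.
    by rewrite ler_weXn2l// ler1n ltnW.
  have [l' [k' hr]] := approx_step ht hc hpi hpi1 heta hge hg C0 Csub Cmono Crat he h2 N.
  by exists (l', k') => _.
have /choice[f hf] : forall N, exists fN, forall s, inv s -> rel N s (fN s).
  by move=> N; have [fN hN] := choice (hstep N); exists fN.
pose st := fix st n := if n is m.+1 then f m (st m) else (i0, k0).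
have inv_st n : inv (st n).
  elim: n => [|n IH]; first by split.
  have [h1 _ _ _ h2] := hf n _ IH; split; first exact: leq_trans IH.1 (ltnW h1).
  have hx := cint_left R hc (st n.+1).1 (st n.+1).2.
  have := h2 _ _ (introT andP (conj (ltnW h1) (leqnn _))) hx.
  by rewrite [cfloor _ _ _]hx.
have hrel n : rel n (st n) (st n.+1) := hf n _ (inv_st n).
have [x hx] : exists x : R, forall n, (st n).2%:~R / c%:R ^+ (st n).1 < x <
    ((st n).2%:~R + 1) / c%:R ^+ (st n).1.
  apply: (@nested_cadic_point R c (fun n => (st n).1) (fun n => (st n).2)) => n;
    by have [] := hrel n.
have xst n : cint c (st n).1 (st n).2 x.
  by apply/(cintP' hc); have /andP[/ltW -> ->] := hx n.
have xF : approx_Gdelta pi_ t x.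
  move=> N _; have [_ _ _ h _] := hrel N.
  exact: (interior_cint hc h (hx N.+1)).
have [p _ xp] := hcov x (conj xF (xst 0%N)).
have [[i [k lp]]|lp0] := hl p; last by rewrite lp0 in xp.
have ii0 : (i0 < i)%N.
  rewrite ltnNge; apply/negP => ii0; apply: hnot; exists p; rewrite lp.
  apply: (cint_nested hc ii0 (x := x)); first by rewrite -lp.
  exact: xst 0%N.
have lpJ : l p `<=` cint c i0 k0.
  rewrite lp; apply: (cint_nested hc (ltnW ii0) (xst 0%N)).
  by rewrite -lp.
have [n hn] : exists n, ((st n).1 <= i < (st n.+1).1)%N.
  rewrite -(subnKC (ltnW ii0)); elim: (i - i0)%N => [|m [n /andP[h1 h2]]].
    by exists 0%N; rewrite addn0 leqnn; have [] := hrel 0%N.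
  have [h|h] := ltnP (i0 + m.+1) (st n.+1).1.
    by exists n; rewrite h andbT (leq_trans h1)// leq_add2l.
  exists n.+1; rewrite h; have [h3 _ _ _ _] := hrel n.+1.
  by apply: leq_ltn_trans h3; rewrite addnS.
have [_ _ _ _ hg1] := hrel n.
have /andP[hn1 hn2] := hn.
have := hg1 i x _ (xst n.+1); rewrite hn1 (ltnW hn2) => /(_ isT).
have -> : cfloor c i x = k by move: xp; rewrite lp.
apply/negP; rewrite -leNgt.
apply: le_trans (Cw i k p _); last by rewrite lp.
by rewrite /w asboolT// lp (diam_cint R hc).
Qed.

End LocalCost.

(** * Net measures *)

Section NetMeasure.
Context (R : realType) (t : R) (ht : 1 <= t) (c : nat) (hc : (2 <= c)%N).
Context (pi_ : 'I_c -> R) (hpi : forall b, 0 < pi_ b < 1).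
Context (hpi1 : \sum_(b < c) pi_ b = 1) (eta : R) (heta : 0 < eta < 8^-1).
Context (g : R -> R) (hgD : gaugeD1 g).
Hypothesis hg : gauge_prec g (h_ (entropy pi_ / t) (fun r => 3 * f_ eta r)).

Lemma gauge_eps_gt0 : 0 < gauge_eps g.
Proof.
have [_ [e e0 he]] := hgD.
apply: (@lt_le_trans _ _ (Num.min e 1)); first by rewrite lt_min e0 ltr01.
apply: ub_le_sup; first by exists 1 => x [].
split; [by rewrite lt_min e0 ltr01|by rewrite ge_min lexx orbT|].
by apply: gauge_on_le he; rewrite ge_min lexx.
Qed.

Let c0 i : 0 < c%:R ^- i :> R. Proof. by rewrite invr_gt0 exprn_gt0// ltr0n ltnW. Qed.

Lemma cint_subset_open (U : set R) x : open U -> U x ->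
  exists i, c%:R ^- i < gauge_eps g /\ cint c i (cfloor c i x) `<=` U.
Proof.
move=> oU Ux.
have /nbhs_ballP[d /= d0 hd] : nbhs x U by apply: open_nbhs_nbhs.
have md0 : 0 < Num.min d (gauge_eps g) by rewrite lt_min d0 gauge_eps_gt0.
have [i /(_ i (leqnn _))] := cinv_lt hc md0; rewrite lt_min => /andP[id ie].
exists i; split=> // z hz; apply: hd; rewrite /ball/=.
apply: le_lt_trans id; rewrite distrC.
apply: (@cint_dist _ _ hc i (cfloor c i x)) => //.
by have /(cintP' hc)/andP[-> /ltW ->] := hz.
Qed.

(** From a cover of the smaller set a cover of [U] of no larger cost is made. The set [mx x] is the
    largest admissible c-adic interval of [U] around [x]; if no element contains it, [local_cost]
    allows it to replace all elements inside it. *)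
Lemma net_measure_approx (U : set R) : open U ->
  net_measure c g (approx_Gdelta pi_ t `&` U) = net_measure c g U.
Proof.
move=> oU; have [g0 _] := hgD.
apply/eqP; rewrite eq_le; apply/andP; split.
  apply: ereal_inf_le_tmp => _ [l [h1 h2 h3] <-]; exists l => //.
  by split=> //; apply: subset_trans h2; exact: subIsetr.
apply/ereal_infP => _ [l [hl0 hcov hd] <-].
have hl p : (exists i k, l p = cint c i k) \/ l p = set0.
  have [h|] := hl0 p; last by right.
  by left; apply: cadic_lt1 => //; apply: lt_le_trans (hd p) (gauge_eps_le1 g).
have gl p : 0 <= g (diam (l p)).
  have := hd p; have [[i [k ->]]|->] := hl p; last by rewrite diam_set0 g0.
  rewrite diam_cint// => /(lt_gauge_eps (ltW (c0 i)))[e he hge].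
  by apply/ltW/(gauge_gt0 hge); rewrite c0 ltW.
pose lev (x : R) i := c%:R ^- i < gauge_eps g /\ cint c i (cfloor c i x) `<=` U.
have /choice[lv hlv] : forall x, exists i, U x -> lev x i /\
    forall j, lev x j -> (i <= j)%N.
  move=> x; have [Ux|nUx] := pselect (U x); last by exists 0%N.
  have hex : exists i, `[< lev x i >].
    by have [i hi] := cint_subset_open oU Ux; exists i; apply/asboolP.
  case: (ex_minnP hex) => i /asboolP hi hmin; exists i => _; split=> // j hj.
  by apply: hmin; apply/asboolP.
pose mx (x : R) := cint c (lv x) (cfloor c (lv x) x) : set R.
have mx_self (x : R) : mx x x by [].
have mxU x : U x -> mx x `<=` U by move=> /hlv[[_]].
have mx_max x i k : U x -> cint c i k x -> cint c i k `<=` U ->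
    c%:R ^- i < gauge_eps g -> cint c i k `<=` mx x.
  move=> Ux hx hU hi; have ke : cfloor c i x = k := hx.
  apply: (cint_nested hc _ (mx_self x) hx); apply: (hlv x Ux).2.
  by split=> //; rewrite ke.
have l_mx q x : l q x -> l q `<=` U -> l q `<=` mx x.
  move=> lx lU; have [[i [k e]]|e] := hl q; last by rewrite e.
  rewrite e; apply: mx_max; rewrite -?e//; first exact: lU.
  by have := hd q; rewrite e diam_cint.
have mx_eq x y : U x -> mx x y -> mx y = mx x.
  move=> Ux xy; have Uy := mxU _ Ux _ xy.
  have xy' : cfloor c (lv x) y = cfloor c (lv x) x := xy.
  have [[lx1 lx2] lx3] := hlv x Ux; have [[ly1 ly2] ly3] := hlv y Uy.
  have yx : (lv y <= lv x)%N by apply: ly3; split=> //; rewrite xy'.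
  have e : cfloor c (lv y) y = cfloor c (lv y) x := cfloor_le hc yx xy'.
  have xy2 : (lv x <= lv y)%N by apply: lx3; split=> //; rewrite -e.
  have elv : lv x = lv y by apply/eqP; rewrite eqn_leq xy2 yx.
  by rewrite /mx -elv xy'.
have mx_cost x : U x -> ~ (exists r, mx x `<=` l r) ->
    ((g (diam (mx x)))%:E <= \sum_(0 <= q <oo)
      (if `[< l q `<=` mx x >] then g (diam (l q)) else 0)%:E)%E /\
    0 < g (diam (mx x)).
  move=> Ux hno; have [[lx _] _] := hlv x Ux.
  have [e he hge] := lt_gauge_eps (ltW (c0 (lv x))) lx.
  rewrite diam_cint//; split; last by apply: (gauge_gt0 hge); rewrite c0 ltW.
  apply: (local_cost ht hc hpi hpi1 heta hge g0 hg (ltW he) hl gl) => //.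
  by apply: subset_trans hcov; apply: setIS; exact: mxU.
have /choice[xq hxq] : forall q, exists x, l q !=set0 -> l q x.
  by move=> q; have [[x h]|h] := pselect (l q !=set0); [exists x|exists 0].
(* The indices of the elements to be replaced; [memb q] is the group of those inside the same
   maximal interval. *)
pose Grp q := [/\ l q !=set0, l q `<=` U & ~ exists r, mx (xq q) `<=` l r].
pose memb q p := l p !=set0 /\ l p `<=` mx (xq q).
have Grp_U q : Grp q -> U (xq q) by move=> [/hxq h hU _]; exact: hU.
have Grp_memb q : Grp q -> memb q q.
  by move=> [n0 hU _]; split=> //; apply: l_mx => //; exact: hxq.
have memb_mx q p : U (xq q) -> memb q p -> mx (xq p) = mx (xq q).
  by move=> Uq [/hxq h1 h2]; apply: mx_eq => //; exact: h2.
have memb_Grp q p : Grp q -> memb q p -> Grp p.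
  move=> Gq qp; have Uq := Grp_U _ Gq; have [_ _ hno] := Gq; have [h1 h2] := qp.
  by split=> //; [exact: subset_trans h2 (mxU _ Uq)|rewrite (memb_mx q)].
(* The least index of each group represents it and receives the maximal interval, which is thus paid
   for only once; other members become empty. *)
have /choice[rep hrep] : forall q, exists p, (Grp q -> memb q p /\
    forall p', memb q p' -> (p <= p')%N) /\ (~ Grp q -> p = q).
  move=> q; have [Gq|nGq] := pselect (Grp q); last by exists q.
  have hex : exists p, `[< memb q p >] by exists q; apply/asboolP/Grp_memb.
  case: (ex_minnP hex) => p /asboolP hp hmin; exists p; split=> // _; split=> //.
  by move=> p' hp'; apply: hmin; apply/asboolP.
have rep_eq q p : Grp q -> memb q p -> rep p = rep q.
  move=> Gq qp; have Gp := memb_Grp _ _ Gq qp.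
  have e := memb_mx _ _ (Grp_U _ Gq) qp.
  have [q1 q2] := (hrep q).1 Gq; have [p1 p2] := (hrep p).1 Gp.
  apply/eqP; rewrite eqn_leq p2 ?q2//.
    by move: p1; rewrite /memb e.
  by move: q1; rewrite /memb e.
pose l' p := if `[< Grp p >] then (if rep p == p then mx (xq p) else set0) else l p.
have l'G p : Grp p -> rep p = p -> l' p = mx (xq p).
  by move=> Gp e; rewrite /l' asboolT// e eqxx.
have l'0 p : Grp p -> rep p != p -> l' p = set0.
  by move=> Gp /negPf e; rewrite /l' asboolT// e.
have l'l p : ~ Grp p -> l' p = l p by move=> Gp; rewrite /l' asboolF.
apply: (@le_trans _ _ (\sum_(0 <= p <oo) (g (diam (l' p)))%:E)%E).
  apply: ereal_inf_lbound; exists l' => //; split.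
  - move=> p; have [Gp|Gp] := pselect (Grp p); last by rewrite l'l.
    have [e|e] := eqVneq (rep p) p; last by right; rewrite l'0.
    by left; rewrite l'G//; exact: cadic_cint.
  - move=> x Ux; have [[r hr]|hno] := pselect (exists r, mx x `<=` l r).
      exists r => //; rewrite l'l; first exact: hr.
      move=> Gr; have [n0 rU hnr] := Gr; apply: hnr; exists r.
      have h : mx x (xq r) by apply: (l_mx r x (hr _ (mx_self x)) rU); exact: hxq.
      by rewrite (mx_eq _ _ Ux h).
    (* Otherwise the sum in [mx_cost] would vanish, although the gauge of [mx x] is positive. *)
    have [q [q0 qx]] : exists q, l q !=set0 /\ l q `<=` mx x.
      apply: contrapT => /forallNP hn; have [] := mx_cost _ Ux hno.
      rewrite eseries0; first by rewrite lee_fin leNgt => /negP.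
      move=> q _ _; case: asboolP => // lx.
      have [->|/set0P lq0] := eqVneq (l q) set0; first by rewrite diam_set0 g0.
      by case: (hn q).
    have mxq : mx (xq q) = mx x by apply: mx_eq => //; apply: qx; exact: hxq.
    have Gq : Grp q by split=> //; [exact: subset_trans qx (mxU _ Ux)|rewrite mxq].
    have [hm _] := (hrep q).1 Gq; have e := rep_eq _ _ Gq hm.
    exists (rep q) => //; rewrite l'G//; last exact: memb_Grp hm.
    by rewrite (memb_mx _ _ (Grp_U _ Gq) hm) mxq.
  - move=> p; have [Gp|Gp] := pselect (Grp p); last by rewrite l'l.
    have [e|e] := eqVneq (rep p) p; last first.
      by rewrite l'0// diam_set0; exact: gauge_eps_gt0.
    by rewrite l'G// diam_cint//; have [[]] := hlv _ (Grp_U _ Gp).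
(* The old costs are regrouped by representative, and the two series are then compared group by
   group. *)
pose T p q : R := if rep q == p then g (diam (l q)) else 0.
have T0 p q : 0 <= T p q by rewrite /T; case: ifP.
have TE0 p q : (0 <= (T p q)%:E)%E by rewrite lee_fin.
have -> : (\sum_(0 <= q <oo) (g (diam (l q)))%:E =
    \sum_(0 <= p <oo) \sum_(0 <= q <oo) (T p q)%:E)%E.
  rewrite nneseries_interchange; last by move=> *; exact: TE0.
  apply: eq_eseriesr => q _.
  rewrite (nneseriesD1 (n := rep q))// eseries0 ?adde0; first by rewrite /T eqxx.
  by move=> p _ /andP[_ pq]; rewrite /T eq_sym (negPf pq).
apply: lee_nneseries => [p _ _|p _].
  rewrite lee_fin; have [Gp|Gp] := pselect (Grp p); last by rewrite l'l.
  have [e|e] := eqVneq (rep p) p; last by rewrite l'0// diam_set0 g0.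
  by rewrite l'G//; have [_ _ hno] := Gp; have [_ /ltW] := mx_cost _ (Grp_U _ Gp) hno.
have [Gp|nGp] := pselect (Grp p); last first.
  rewrite l'l//; have e := (hrep p).2 nGp.
  rewrite (nneseriesD1 (n := p))// [X in (_ <= X + _)%E](_ : _ = (g (diam (l p)))%:E).
    by rewrite leeDl// nneseries_ge0.
  by rewrite /T e eqxx.
have [e|e] := eqVneq (rep p) p; last first.
  by rewrite l'0// diam_set0 g0 nneseries_ge0.
rewrite l'G//; have [_ _ hno] := Gp; have Up := Grp_U _ Gp.
apply: le_trans (mx_cost _ Up hno).1 _; apply: lee_nneseries => [q _ _|q _].
  by rewrite lee_fin; case: ifP.
rewrite lee_fin; case: asboolP => // hq.
have [q0|/set0P q0] := eqVneq (l q) set0; first by rewrite q0 diam_set0 g0.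
by rewrite /T (rep_eq _ _ Gp (conj q0 hq)) e eqxx.
Qed.

End NetMeasure.

(** * Inclusion in the set of approximable points and conclusion *)

Lemma approx_Gdelta_sub (R : realType) (t : R) (c : nat) (pi_ : 'I_c -> R) :
  approx_Gdelta pi_ t `<=` U' pi_ t.
Proof.
move=> x hx.
have /choice[pq hpq] : forall n, exists pq : int * nat,
    [/\ (n <= pq.2)%N, (0 < pq.2)%N /\ coprime `|pq.1|%N pq.2,
        `|x - pq.1%:~R / pq.2%:R| <= pq.2%:R `^ (- (2 * t))
      & forall b : 'I_c,
          `|sigma c b (Num.truncn (2 * logb c (pq.2%:R : R))) x - pi_ b|
            < n.+1%:R^-1].
  by move=> n; have [p [q h]] := interior_subset (hx n I); exists (p, q).
exists (fun n => (pq n).1), (fun n => (pq n).2); split.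
- by move=> n; have [] := hpq n.
- apply/cvgnyPge => A; exists A => // n /= An.
  by have [h _ _ _] := hpq n; exact: leq_trans h.
- by move=> n; have [] := hpq n.
- move=> b; apply/cvgrPdist_lt => e e0.
  exists (Num.truncn e^-1) => // n /= hn; rewrite distrC.
  have [_ _ _ /(_ b) h] := hpq n; apply: (lt_trans h).
  rewrite invf_plt ?posrE//; apply: (lt_le_trans (truncnS_gt _)).
  by rewrite ler_nat.
Qed.

Theorem mainTheorem4 (R : realType) (t : R) (ht : 1 <= t)
  (c : nat) (hc : (2 <= c)%N)
  (pi_ : 'I_c -> R) (hpi : forall b, 0 < pi_ b < 1)
  (hpi1 : \sum_(b < c) pi_ b = 1)
  (eta : R) (heta : 0 < eta < 8^-1) :
  exists F : set R,
    large_intersection c (h_ (entropy pi_ / t) (fun r => 3 * f_ eta r)) F /\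
    F `<=` U' pi_ t.
Proof.
exists (approx_Gdelta pi_ t); split; last exact: approx_Gdelta_sub.
split.
  by exists (fun N => interior (approx_set pi_ t N)) => // N; exact: open_interior.
by move=> g gD hg U oU; exact: (net_measure_approx ht hc hpi hpi1 heta gD hg oU).
Qed.
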